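(* Let $n\ge2$, $q\in\mathbb{C}^\times$ not a root of unity, and $a,b,c\in\mathbb{C}$. Let $\mathcal{D}_i^{(1,1)}$ ($1\le i\le n$) be the elements of the $GL_n$-type double affine Hecke algebra $\mathbb{H}_n$ given by $\mathcal{D}^{(1,1)}_n=X_n^{-1}(aY_n+bY_n^{-1}+c)$ and $\mathcal{D}^{(1,1)}_i=T_i\cdots T_{n-1}\,\mathcal{D}^{(1,1)}_n\,T_{n-1}\cdots T_i$ for $1\le i\le n-1$, acting in the polynomial representation. Then $$\operatorname{Res}\left(\sum_{i=1}^n\mathcal{D}_i^{(1,1)}\right)=a\tau^{1-n}\sum_{i=1}^n\frac1{X_i}\left(\prod_{1\le j\le n,\, j\ne i}\frac{\tau^2X_i-X_j}{X_i-X_j}\right)t_i+b\tau^{1-n}\sum_{i=1}^n\frac1{X_i}\left(\prod_{1\le j\le n,\, j\ne i}\frac{X_i-\tau^2X_j}{X_i-X_j}\right)t_i^{-1}+c\sum_{i=1}^n\frac1{X_i}.$$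
   Context: **DAHA.** $\mathbb{C}_\tau=\mathbb{C}[\tau^{\pm1}]$, $\tau$ formal. $\mathbb{H}_n$ is the unital associative $\mathbb{C}_\tau$-algebra generated by $T_k$ ($1\le k\le n-1$), $X_i^{\pm1}$, $Y_i^{\pm1}$ ($1\le i\le n$) with relations: $(T_k-\tau)(T_k+\tau^{-1})=0$; $T_lT_{l+1}T_l=T_{l+1}T_lT_{l+1}$; $[T_k,T_l]=0$ if $|k-l|>1$; $T_kX_kT_k=X_{k+1}$, $[T_k,X_i]=0$ for $i\ne k,k+1$; $T_k^{-1}Y_kT_k^{-1}=Y_{k+1}$, $[T_k,Y_i]=0$ for $i\neq k,k+1$; $\widetilde Y X_i=qX_i\widetilde Y$ with $\widetilde Y=\prod_{i=1}^nY_i$; $Y_2^{-1}X_1Y_2X_1^{-1}=T_1^2$; the $X_i^{\pm1}$ are mutually inverse and commute with each other, and likewise the $Y_i^{\pm1}$. **Polynomial representation.** $\mathbb{H}_n$ acts faithfully on $\mathbb{C}_\tau[X_1^{\pm1},\dots,X_n^{\pm1}]$: $X_i^{\pm1}$ by multiplication, $T_k$ as $\tau s_k+\frac{\tau-\tau^{-1}}{X_kX_{k+1}^{-1}-1}(s_k-1)$ where $s_k$ swaps $X_k,X_{k+1}$, and $Y_i=T_iT_{i+1}\cdots T_{n-1}\,\pi^{-1}\,T_1^{-1}T_2^{-1}\cdots T_{i-1}^{-1}$, where $\pi^{-1}(X_1^{a_1}\cdots X_n^{a_n})=q^{a_1}X_1^{a_2}\cdots X_{n-1}^{a_n}X_n^{a_1}$.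 **Res.** Let $t_i$ be the $q$-shift operator $(t_if)(X_1,\dots,X_n)=f(X_1,\dots,qX_i,\dots,X_n)$. An element of $\mathbb{H}_n$ acts as a finite sum $f=\sum_{\mathbf{k}\in\mathbb{Z}^n,\,w\in\mathfrak{S}_n}g_{\mathbf{k},w}\,t_1^{k_1}\cdots t_n^{k_n}\,w$ with $g_{\mathbf{k},w}$ rational functions of $X_1,\dots,X_n$ (over $\mathbb{C}_\tau$), where $w\in\mathfrak{S}_n$ permutes variables; $\operatorname{Res}(f)=\sum_{\mathbf{k},w}g_{\mathbf{k},w}\,t_1^{k_1}\cdots t_n^{k_n}$. *)

(* Defs.v *)
From HB Require Import structures.
From mathcomp Require Import all_boot all_order all_fingroup all_algebra.
From mathcomp Require Import generic_quotient fraction finmap.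
From mathcomp Require Import mpoly.
From mathcomp Require Import boolp classical_sets reals.
From mathcomp Require Import complex.

Set Implicit Arguments.
Unset Strict Implicit.
Unset Printing Implicit Defensive.

Import Order.TTheory GRing.Theory Num.Theory.
Local Open Scope ring_scope.
Local Open Scope quotient_scope.

Section RationalFunctions.
Variables (n : nat) (R : idomainType).

Definition ratf := {fraction {mpoly R[n]}}.
HB.instance Definition _ := GRing.Field.on ratf.

Definition ratC (c : R) : ratf := FracField.tofrac c%:MP.
Definition ratX (i : 'I_n) : ratf := FracField.tofrac 'X_i.

(* f(u_1, ..., u_n), computed on the representative of the fraction f chosen
   by repr.  It is only meaningful when the u_i are algebraically independent
   over R, so that no nonzero denominator is sent to 0; every u used below is
   a permutation of the variables up to nonzero constants. *)
Definition ratsubst (u : 'I_n -> ratf) (f : ratf) : ratf :=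
  mmap ratC u (\n_(repr f)) / mmap ratC u (\d_(repr f)).

Definition laurent_pred : {pred ratf} :=
  fun f => `[< exists (p : {mpoly R[n]}) (m : 'X_{1..n}),
               f = FracField.tofrac p / FracField.tofrac 'X_[m] >].

Lemma laurent_predP f :
  reflect (exists (p : {mpoly R[n]}) (m : 'X_{1..n}),
            f = FracField.tofrac p / FracField.tofrac 'X_[m])
          (f \in laurent_pred).
Proof. exact: asboolP. Qed.

Lemma tofracX_neq0 (m : 'X_{1..n}) :
  FracField.tofrac ('X_[m] : {mpoly R[n]}) != 0.
Proof.
rewrite tofrac_eq0; apply/eqP => /(congr1 (mcoeff m)).
by rewrite mcoeffX eqxx mcoeff0 => /eqP; rewrite oner_eq0.
Qed.

Lemma laurent_subring : subring_closed laurent_pred.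
Proof.
split=> [|f g|f g].
- apply/laurent_predP; exists 1, 0%MM.
  by rewrite mpolyX0 tofrac1 divr1.
- move=> /laurent_predP[p [m ->]] /laurent_predP[p' [m' ->]].
  apply/laurent_predP; exists (p * 'X_[m'] - p' * 'X_[m]), (m + m')%MM.
  rewrite mpolyXD tofracB !tofracM.
  by rewrite -mulNr addf_div ?tofracX_neq0// mulNr.
- move=> /laurent_predP[p [m ->]] /laurent_predP[p' [m' ->]].
  apply/laurent_predP; exists (p * p'), (m + m')%MM.
  by rewrite mpolyXD !tofracM mulf_div.
Qed.

HB.instance Definition _ :=
  GRing.isSubringClosed.Build ratf laurent_pred laurent_subring.

(* R[X_1^{+-1}, ..., X_n^{+-1}], as a subring of R(X_1, ..., X_n) *)
Record laurent := Laurent { laurent_val :> ratf; _ : laurent_val \in laurent_pred }.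

HB.instance Definition _ := [isSub for laurent_val].
HB.instance Definition _ := [Choice of laurent by <:].
HB.instance Definition _ := [SubChoice_isSubComNzRing of laurent by <:].

Definition laurent_unit : {pred laurent} :=
  fun f => (val f != 0) && ((val f)^-1 \in laurent_pred).
Definition laurent_inv (f : laurent) : laurent :=
  if f \in laurent_unit then insubd f (val f)^-1 else f.

Lemma laurent_mulVf : {in laurent_unit, left_inverse 1 laurent_inv *%R}.
Proof.
move=> f fU; rewrite /laurent_inv fU; move: fU => /andP[f0 fV].
by apply: val_inj; rewrite rmorphM rmorph1 /= insubdK// mulVf.
Qed.

Lemma laurent_unitPl (f g : laurent) : g * f = 1 -> f \in laurent_unit.
Proof.
move=> /(congr1 val); rewrite rmorphM rmorph1 /= => gf1.
have f0 : val f != 0.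
  by apply/eqP => f0; move/eqP: gf1; rewrite f0 mulr0 eq_sym oner_eq0.
by apply/andP; split=> //; rewrite -[_^-1]mul1r -gf1 mulfK// (valP g).
Qed.

Lemma laurent_inv_out : {in [predC laurent_unit], laurent_inv =1 id}.
Proof. by move=> f /negbTE fU; rewrite /laurent_inv fU. Qed.

HB.instance Definition _ := GRing.ComNzRing_hasMulInverse.Build laurent
  laurent_mulVf laurent_unitPl laurent_inv_out.

Lemma laurent_mulf_eq0 : GRing.integral_domain_axiom laurent.
Proof.
move=> f g /(congr1 val); rewrite rmorphM rmorph0 => /eqP; rewrite mulf_eq0.
by move=> /orP[]/eqP h0; apply/orP; [left|right]; apply/eqP/val_inj;
  rewrite h0 rmorph0.
Qed.
HB.instance Definition _ :=
  GRing.ComUnitRing_isIntegral.Build laurent laurent_mulf_eq0.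

Lemma laurentX_proof (i : 'I_n) : ratX i \in laurent_pred.
Proof.
by apply/laurent_predP; exists 'X_i, 0%MM; rewrite mpolyX0 tofrac1 divr1.
Qed.
Definition laurentX (i : 'I_n) : laurent := Laurent (laurentX_proof i).

Lemma laurentC_proof (c : R) : ratC c \in laurent_pred.
Proof.
by apply/laurent_predP; exists c%:MP, 0%MM; rewrite mpolyX0 tofrac1 divr1.
Qed.
Definition laurentC (c : R) : laurent := Laurent (laurentC_proof c).

Lemma laurentC_is_zmod_morphism : zmod_morphism laurentC.
Proof.
move=> c d; apply: val_inj.
by rewrite rmorphB /= /ratC mpolyCB tofracB.
Qed.
Lemma laurentC_is_monoid_morphism : monoid_morphism laurentC.
Proof.
split=> [|c d]; apply: val_inj; first by rewrite rmorph1 /= /ratC tofrac1.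
by rewrite rmorphM /= /ratC mpolyCM tofracM.
Qed.
HB.instance Definition _ :=
  GRing.isZmodMorphism.Build R laurent laurentC laurentC_is_zmod_morphism.
HB.instance Definition _ :=
  GRing.isMonoidMorphism.Build R laurent laurentC laurentC_is_monoid_morphism.

Definition laurent_scale (c : R) (f : laurent) : laurent := laurentC c * f.
Lemma laurent_scaleA a b v :
  laurent_scale a (laurent_scale b v) = laurent_scale (a * b) v.
Proof. by rewrite /laurent_scale rmorphM mulrA. Qed.
Lemma laurent_scale1 : left_id 1 laurent_scale.
Proof. by move=> v; rewrite /laurent_scale rmorph1 mul1r. Qed.
Lemma laurent_scaleDr : right_distributive laurent_scale +%R.
Proof. by move=> a u v; exact: mulrDr. Qed.
Lemma laurent_scaleDl v : {morph laurent_scale^~ v : a b / a + b}.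
Proof. by move=> a b; rewrite /laurent_scale rmorphD mulrDl. Qed.
HB.instance Definition _ := GRing.Zmodule_isLmodule.Build R laurent
  laurent_scaleA laurent_scale1 laurent_scaleDr laurent_scaleDl.
Lemma laurent_scaleAl (a : R) (u v : laurent) : a *: (u * v) = (a *: u) * v.
Proof. exact: mulrA. Qed.
HB.instance Definition _ :=
  GRing.Lmodule_isLalgebra.Build R laurent laurent_scaleAl.

End RationalFunctions.

(* K[tau^{+-1}]; the theorem takes K = C. *)
Notation Ctau K := (laurent 1 K).
Definition tau {K : idomainType} : Ctau K := laurentX K ord0.
Definition cst {K : idomainType} : K -> Ctau K := @laurentC 1 K.

(* The index k : 'I_n.-1 of T_k, seen in 'I_n as k and as k + 1. *)
Definition idx n (k : 'I_n.-1) : 'I_n := widen_ord (leq_pred n) k.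
Definition idxS n (k : 'I_n.-1) : 'I_n :=
  Ordinal (etrans (esym (ltn_predRL k n)) (ltn_ord k)).

Section DAHA.
Variables (n : nat) (K : fieldType) (q : K).

(* GX i false stands for X_i and GX i true for X_i^{-1}; similarly for GY. *)
Inductive daha_gen := GT of 'I_n.-1 | GX of 'I_n & bool | GY of 'I_n & bool.

Inductive daha_word :=
  | Scal of Ctau K
  | Gen of daha_gen
  | Add of daha_word & daha_word
  | Mul of daha_word & daha_word.

Declare Scope word_scope.
Delimit Scope word_scope with W.
Bind Scope word_scope with daha_word.
Local Notation "a + b" := (Add a b) : word_scope.
Local Notation "a * b" := (Mul a b) : word_scope.
Local Notation "a - b" := (Add a (Mul (Scal (-1)) b)) : word_scope.
Local Notation T k := (Gen (GT k)).
Local Notation X i := (Gen (GX i false)).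
Local Notation Y i := (Gen (GY i false)).
Local Notation XV i := (Gen (GX i true)).
Local Notation YV i := (Gen (GY i true)).
(* The inverse of T_k provided by the quadratic relation. *)
Local Notation TV k := (Gen (GT k) - Scal (tau - tau^-1)%R)%W.

Local Open Scope word_scope.
(* The congruence generated by the axioms of unital associative
   C_tau-algebras and the defining relations of the DAHA. *)
Inductive daha_eq : daha_word -> daha_word -> Prop :=
  | daha_refl u : daha_eq u u
  | daha_sym u v : daha_eq u v -> daha_eq v u
  | daha_trans u v w : daha_eq u v -> daha_eq v w -> daha_eq u w
  | daha_add u u' v v' :
      daha_eq u u' -> daha_eq v v' -> daha_eq (u + v) (u' + v')
  | daha_mul u u' v v' :
      daha_eq u u' -> daha_eq v v' -> daha_eq (u * v) (u' * v')
  | daha_addA u v w : daha_eq (u + (v + w)) (u + v + w)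
  | daha_addC u v : daha_eq (u + v) (v + u)
  | daha_add0 u : daha_eq (Scal 0 + u) u
  | daha_mulA u v w : daha_eq (u * (v * w)) (u * v * w)
  | daha_mul1l u : daha_eq (Scal 1 * u) u
  | daha_mul1r u : daha_eq (u * Scal 1) u
  | daha_mul0 u : daha_eq (Scal 0 * u) (Scal 0)
  | daha_mulDl u v w : daha_eq ((u + v) * w) (u * w + v * w)
  | daha_mulDr u v w : daha_eq (u * (v + w)) (u * v + u * w)
  | daha_scalD a b : daha_eq (Scal (a + b)%R) (Scal a + Scal b)
  | daha_scalM a b : daha_eq (Scal (a * b)%R) (Scal a * Scal b)
  | daha_scalC a u : daha_eq (Scal a * u) (u * Scal a)
  | daha_quad k : daha_eq ((T k - Scal tau) * (T k + Scal tau^-1)) (Scal 0)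
  | daha_braid (k l : 'I_n.-1) : l = k.+1 :> nat ->
      daha_eq (T k * T l * T k) (T l * T k * T l)
  | daha_TT (k l : 'I_n.-1) : (k.+1 < l)%N || (l.+1 < k)%N ->
      daha_eq (T k * T l) (T l * T k)
  | daha_TXT k : daha_eq (T k * X (idx k) * T k) (X (idxS k))
  | daha_TX k i : i != idx k -> i != idxS k -> daha_eq (T k * X i) (X i * T k)
  | daha_TYT k : daha_eq (TV k * Y (idx k) * TV k) (Y (idxS k))
  | daha_TY k i : i != idx k -> i != idxS k -> daha_eq (T k * Y i) (Y i * T k)
  | daha_qcomm i (Yt := \big[Mul/Scal 1]_(j < n) Y j) :
      daha_eq (Yt * X i) (Scal (cst q) * X i * Yt)
  | daha_YXYX (k : 'I_n.-1) : k = 0%N :> nat ->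
      daha_eq (YV (idxS k) * X (idx k) * Y (idxS k) * XV (idx k)) (T k * T k)
  | daha_XV i e : daha_eq (Gen (GX i e) * Gen (GX i (~~ e))) (Scal 1)
  | daha_YV i e : daha_eq (Gen (GY i e) * Gen (GY i (~~ e))) (Scal 1)
  | daha_XX i e j e' :
      daha_eq (Gen (GX i e) * Gen (GX j e')) (Gen (GX j e') * Gen (GX i e))
  | daha_YY i e j e' :
      daha_eq (Gen (GY i e) * Gen (GY j e')) (Gen (GY j e') * Gen (GY i e)).
Local Close Scope word_scope.

HB.instance Definition _ := gen_eqMixin daha_word.
HB.instance Definition _ := gen_choiceMixin daha_word.

Definition daha_eqb (u v : daha_word) : bool := `[< daha_eq u v >].

Lemma daha_eqb_refl : reflexive daha_eqb.
Proof. by move=> u; apply/asboolP; exact: daha_refl. Qed.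
Lemma daha_eqb_sym : ssrbool.symmetric daha_eqb.
Proof. by move=> u v; apply/asboolP/asboolP; exact: daha_sym. Qed.
Lemma daha_eqb_trans : transitive daha_eqb.
Proof.
move=> v u w /asboolP uv /asboolP vw; apply/asboolP; exact: daha_trans vw.
Qed.

Canonical daha_equiv :=
  EquivRel daha_eqb daha_eqb_refl daha_eqb_sym daha_eqb_trans.

Definition daha := {eq_quot daha_equiv}.
HB.instance Definition _ := Choice.on daha.
HB.instance Definition _ : EqQuotient _ daha_equiv daha := EqQuotient.on daha.

Lemma daha_piP u v : reflect (\pi_daha u = \pi_daha v) `[< daha_eq u v >].
Proof. exact: (@eqquotP _ daha_equiv daha u v). Qed.

Lemma daha_pi u v : daha_eq u v -> \pi_daha u = \pi_daha v.
Proof. by move=> uv; apply/daha_piP/asboolP. Qed.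

Lemma daha_repr u : daha_eq (repr (\pi_daha u)) u.
Proof. by apply/asboolP/daha_piP; rewrite reprK. Qed.

Definition addd := lift_op2 daha Add.
Definition muld := lift_op2 daha Mul.
Definition oppd := lift_op1 daha (Mul (Scal (-1))).

Lemma pi_addd : {morph \pi_daha : u v / Add u v >-> addd u v}.
Proof.
move=> u v; unlock addd; apply: daha_pi.
by apply: daha_sym; apply: daha_add; exact: daha_repr.
Qed.
Lemma pi_muld : {morph \pi_daha : u v / Mul u v >-> muld u v}.
Proof.
move=> u v; unlock muld; apply: daha_pi.
by apply: daha_sym; apply: daha_mul; exact: daha_repr.
Qed.
Lemma pi_oppd : {morph \pi_daha : u / Mul (Scal (-1)) u >-> oppd u}.
Proof.
move=> u; unlock oppd; apply: daha_pi.
by apply: daha_sym; apply: daha_mul; [exact: daha_refl|exact: daha_repr].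
Qed.

Lemma daha_addNw u : daha_eq (Add (Mul (Scal (-1)) u) u) (Scal 0).
Proof.
apply: daha_trans (daha_mul0 u).
apply: (@daha_trans _ (Add (Mul (Scal (-1)) u) (Mul (Scal 1) u))).
  by apply: daha_add; [exact: daha_refl|exact/daha_sym/daha_mul1l].
apply: daha_trans (daha_sym (daha_mulDl _ _ _)) _.
apply: daha_mul; last exact: daha_refl.
by apply: daha_sym; have := daha_scalD (-1) 1; rewrite addNr.
Qed.

Lemma adddA : associative addd.
Proof.
elim/quotW=> u; elim/quotW=> v; elim/quotW=> w.
by rewrite -!pi_addd; exact/daha_pi/daha_addA.
Qed.
Lemma adddC : commutative addd.
Proof.
by elim/quotW=> u; elim/quotW=> v; rewrite -!pi_addd; exact/daha_pi/daha_addC.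
Qed.
Lemma add0d : left_id (\pi_daha (Scal 0)) addd.
Proof. by elim/quotW=> u; rewrite -pi_addd; exact/daha_pi/daha_add0. Qed.
Lemma addNd : left_inverse (\pi_daha (Scal 0)) oppd addd.
Proof.
by elim/quotW=> u; rewrite -pi_oppd -pi_addd; exact/daha_pi/daha_addNw.
Qed.
HB.instance Definition _ := GRing.isZmodule.Build daha adddA adddC add0d addNd.

Lemma muldA : associative muld.
Proof.
elim/quotW=> u; elim/quotW=> v; elim/quotW=> w.
by rewrite -!pi_muld; exact/daha_pi/daha_mulA.
Qed.
Lemma mul1d : left_id (\pi_daha (Scal 1)) muld.
Proof. by elim/quotW=> u; rewrite -pi_muld; exact/daha_pi/daha_mul1l. Qed.
Lemma muld1 : right_id (\pi_daha (Scal 1)) muld.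
Proof. by elim/quotW=> u; rewrite -pi_muld; exact/daha_pi/daha_mul1r. Qed.
Lemma muldDl : left_distributive muld addd.
Proof.
elim/quotW=> u; elim/quotW=> v; elim/quotW=> w.
by rewrite -!(pi_addd, pi_muld); exact/daha_pi/daha_mulDl.
Qed.
Lemma muldDr : right_distributive muld addd.
Proof.
elim/quotW=> u; elim/quotW=> v; elim/quotW=> w.
by rewrite -!(pi_addd, pi_muld); exact/daha_pi/daha_mulDr.
Qed.
(* The library's algType includes 1 != 0, which holds in the DAHA but only
   through a nonzero representation; hence pzRingType, lmodType and the two
   scaling identities below. *)
HB.instance Definition _ :=
  GRing.Zmodule_isPzRing.Build daha muldA mul1d muld1 muldDl muldDr.

Definition scaled (c : Ctau K) (h : daha) : daha := muld (\pi_daha (Scal c)) h.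
Lemma scaledA a b h : scaled a (scaled b h) = scaled (a * b) h.
Proof.
rewrite /scaled muldA -pi_muld; congr muld.
exact/daha_pi/daha_sym/daha_scalM.
Qed.
Lemma scaled1 : left_id 1 scaled.
Proof. exact: mul1d. Qed.
Lemma scaledDr : right_distributive scaled +%R.
Proof. by move=> c u v; exact: muldDr. Qed.
Lemma scaledDl h : {morph scaled^~ h : a b / a + b}.
Proof.
move=> a b; rewrite /scaled -[RHS]muldDl -pi_addd; congr muld.
exact/daha_pi/daha_scalD.
Qed.
HB.instance Definition _ := GRing.Zmodule_isLmodule.Build (Ctau K) daha
  scaledA scaled1 scaledDr scaledDl.

Lemma daha_scalerAl (c : Ctau K) (g h : daha) : c *: (g * h) = (c *: g) * h.
Proof. exact: muldA. Qed.
Lemma daha_scalerAr (c : Ctau K) (g h : daha) : c *: (g * h) = g * (c *: h).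
Proof.
elim/quotW: g => u; elim/quotW: h => v.
rewrite -[LHS]/(muld (\pi_daha (Scal c)) (muld _ _)).
rewrite -[RHS]/(muld _ (muld (\pi_daha (Scal c)) _)) !muldA; congr muld.
by rewrite -!pi_muld; exact/daha_pi/daha_scalC.
Qed.

Definition dT (k : 'I_n.-1) : daha := \pi_daha (Gen (GT k)).
Definition dX (i : 'I_n) : daha := \pi_daha (Gen (GX i false)).
Definition dXV (i : 'I_n) : daha := \pi_daha (Gen (GX i true)).
Definition dY (i : 'I_n) : daha := \pi_daha (Gen (GY i false)).
Definition dYV (i : 'I_n) : daha := \pi_daha (Gen (GY i true)).

End DAHA.

Section PolynomialRepresentation.
Variables (n : nat) (K : fieldType) (q : K).
Local Notation F := (ratf n (Ctau K)).
Local Notation L := (laurent n (Ctau K)).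
Local Notation x := (@ratX n (Ctau K)).
Local Notation "c %:S" := (@ratC n (Ctau K) c) (at level 2, format "c %:S").

(* (w f)(X_1, ..., X_n) = f(X_{w(1)}, ..., X_{w(n)}) *)
Definition permop (w : 'S_n) : F -> F := ratsubst (fun i => x (w i)).

(* t_1^{k_1} ... t_n^{k_n} *)
Definition tpow (k : {ffun 'I_n -> int}) : F -> F :=
  ratsubst (fun i => (cst (q ^ k i))%:S * x i).

Definition tshift (i : 'I_n) (e : int) : F -> F :=
  tpow [ffun j => if j == i then e else 0].

Definition opT (k : 'I_n.-1) (f : F) : F :=
  let skf := permop (tperm (idx k) (idxS k)) f in
  tau%:S * skf
  + (tau - tau^-1)%:S / (x (idx k) * (x (idxS k))^-1 - 1) * (skf - f).

(* T_k^{-1} = T_k - (tau - tau^{-1}) *)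
Definition opTV (k : 'I_n.-1) (f : F) : F := opT k f - (tau - tau^-1)%:S * f.

(* The substitution X_1 -> q X_n, X_i -> X_{i-1} for i > 1, which sends
   X_1^{a_1} ... X_n^{a_n} to q^{a_1} X_1^{a_2} ... X_{n-1}^{a_n} X_n^{a_1};
   ord_pred is the cyclic predecessor. *)
Definition oppi : F -> F :=
  ratsubst (fun i : 'I_n =>
    (if i == 0 :> nat then (cst q)%:S else 1) * x (ord_pred i)).

(* T_i T_{i+1} ... T_{n-1} pi^{-1} T_1^{-1} ... T_{i-1}^{-1} *)
Definition opY (i : 'I_n) (f : F) : F :=
  foldr opT (oppi (foldr opTV f [seq k : 'I_n.-1 <- enum 'I_n.-1 | (k < i)%N]))
    [seq k : 'I_n.-1 <- enum 'I_n.-1 | (i <= k)%N].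

(* rho is the polynomial representation: an action of the C_tau-algebra
   daha n q on L whose generators act by the formulas above. *)
Record polynomial_representation (rho : daha n q -> L -> L) : Prop := {
  rho_addr : forall h, {morph rho h : f g / f + g};
  rho_addl : forall g h f, rho (g + h) f = rho g f + rho h f;
  rho_scale : forall c h f, rho (c *: h) f = c *: rho h f;
  rho_one : forall f, rho 1 f = f;
  rho_mul : forall g h f, rho (g * h) f = rho g (rho h f);
  rho_T : forall k f, rho (dT q k) f = opT k f :> F;
  rho_X : forall i f, rho (dX q i) f = x i * (f : F) :> F;
  rho_XV : forall i f, rho (dXV q i) f = (x i)^-1 * (f : F) :> F;
  rho_Y : forall i f, rho (dY q i) f = opY i f :> F
}.

Definition diffop :=
  {fsfun ({ffun 'I_n -> int} * 'S_n)%type -> F with 0}.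

Definition acts_as (A : L -> L) (g : diffop) : Prop :=
  forall f : L,
    A f = \sum_(kw <- finsupp g) g kw * tpow kw.1 (permop kw.2 f) :> F.

(* For A = \sum_{k, w} g_{k,w} t^k w on L, the operator
   \sum_{k, w} g_{k,w} t^k on rational functions.  The coefficients are unique
   when q is nonzero and not a root of unity, so the choice made by xget is
   immaterial; the default value is junk. *)
Definition Res (A : L -> L) (f : F) : F :=
  let g := xget [fsfun] [set g : diffop | acts_as A g] in
  \sum_(kw <- finsupp g) g kw * tpow kw.1 f.

End PolynomialRepresentation.

Section Hamiltonians.
Variables (n : nat) (n_gt1 : (2 <= n)%N) (K : fieldType) (q : K) (a b c : K).

Definition ord_last : 'I_n :=
  Ordinal (etrans (ltn_predL n) (ltnW n_gt1)).

Definition D11_last : daha n q :=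
  dXV q ord_last *
  (cst a *: dY q ord_last + cst b *: dYV q ord_last + cst c *: (1 : daha n q)).

(* T_i ... T_{n-1} D_n T_{n-1} ... T_i, which is D_n for i = n. *)
Definition D11 (i : 'I_n) : daha n q :=
  \prod_(k <- enum 'I_n.-1 | (i <= k)%N) dT q k * D11_last *
  \prod_(k <- rev (enum 'I_n.-1) | (i <= k)%N) dT q k.

End Hamiltonians.

(* Main.v *)
(* Every element of the DAHA acts on Laurent polynomials as a combination of the
   operators t^k w with rational coefficients.  These are distinct multiplicative
   maps because q is not a root of unity, so by Dedekind's argument they are
   linearly independent, and Res may be computed from any expansion.

   Write T_k = (t + h_k) s_k - h_k, with h_k a rational function.  Then
   Res(A T_k) = t Res(A), while T_k acts from the left on the coefficients of
   Res(A).  Since Y_n = pi^{-1} T_1^{-1} ... T_{n-1}^{-1} and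
   T_k X_{k+1}^{-1} T_k = X_k^{-1}, the three parts of D_i are
     a T_i ... T_{n-1} X_n^{-1} pi^{-1} T_1^{-1} ... T_{i-1}^{-1},
     b X_i^{-1} T_{i-1} ... T_1 pi T_{n-1} ... T_i   and   c X_i^{-1}.
   The coefficients of the residues of T_i ... T_{n-1} X_n^{-1} pi^{-1} and of
   T_{i-1} ... T_1 pi have closed product forms, found by subtracting the
   formulas of the theorem for consecutive numbers of variables; accordingly
   the sums over i telescope. *)
From HB Require Import structures.
Require Import Defs.
From mathcomp Require Import all_boot all_order all_fingroup all_algebra.
From mathcomp Require Import generic_quotient fraction finmap mpoly.
From mathcomp Require Import ring zify.
From mathcomp Require Import boolp classical_sets reals complex.

Set Implicit Arguments.
Unset Strict Implicit.
Unset Printing Implicit Defensive.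

Import GRing.Theory.
Local Open Scope ring_scope.

(** * Substitutions in rational functions *)

Section RationalSubstitution.
Variables (n : nat) (R : idomainType).
Local Notation F := (ratf n R).
Local Notation x := (@ratX n R).
Local Notation C := (@ratC n R).

Definition ratf_poly : {mpoly R[n]} -> F := @FracField.tofrac {mpoly R[n]}.
HB.instance Definition _ := GRing.RMorphism.on ratf_poly.
Local Notation emb := ratf_poly.

Lemma ratf_poly_eq0 p : (emb p == 0) = (p == 0).
Proof. exact: tofrac_eq0. Qed.

HB.instance Definition _ := GRing.RMorphism.copy C
  (ratf_poly \o @mpolyC n R).

Lemma mpoly_rmorph_eq (S : comNzRingType) (f g : {rmorphism {mpoly R[n]} -> S}) :
  (forall c, f c%:MP = g c%:MP) -> (forall i, f 'X_i = g 'X_i) -> f =1 g.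
Proof.
move=> eqC eqX p; rewrite (mpolyE p) !rmorph_sum; apply: eq_bigr => m _.
rewrite -mul_mpolyC !rmorphM eqC mpolyXE_id !rmorph_prod; congr (_ * _).
by apply: eq_bigr => i _; rewrite !rmorphXn /= eqX.
Qed.

Lemma ratf_numden (f : F) :
  f = emb \n_(repr f) / emb \d_(repr f).
Proof.
apply: (canRL (mulfK _)); first by rewrite ratf_poly_eq0 denom_ratioP.
move: (repr f) (reprK f) => r rf.
rewrite -{1}rf /ratf_poly; unlock FracField.tofrac.
(* Both sides are classes of ratios, and classes are equal when the cross products are. *)
rewrite -[LHS]FracField.pi_mul; apply/eqmodP.
rewrite /= FracField.equivfE /= !numden_Ratio ?mulf_neq0 ?oner_neq0 ?denom_ratioP //.
by rewrite !mulr1 mulrC.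
Qed.

Lemma ratfP (f : F) : exists2 pd, pd.2 != 0 & f = emb pd.1 / emb pd.2.
Proof.
by exists (\n_(repr f), \d_(repr f)); [exact: denom_ratioP|exact: ratf_numden].
Qed.

(** The composition laws of permutations, shifts and pi^-1 below reduce through this to a check on
    constants and variables. *)
Lemma ratf_rmorph_eq (S : fieldType) (f g : {rmorphism F -> S}) :
  (forall c, f (C c) = g (C c)) -> (forall i, f (x i) = g (x i)) -> f =1 g.
Proof.
move=> eqC eqX h.
have eqP: f \o emb =1 g \o emb.
  exact: mpoly_rmorph_eq.
by rewrite (ratf_numden h) !fmorph_div; congr (_ / _); apply: eqP.
Qed.

Lemma ratX_neq0 i : x i != 0.
Proof. exact: (@tofracX_neq0 n R U_(i)%MM). Qed.

Lemma ratX_inj : injective x.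
Proof.
move=> i j /eqP; rewrite tofrac_eq => /eqP/(congr1 (mcoeff U_(i)%MM)).
rewrite !mcoeffX eqxx /=; case: eqP => [/(congr1 (fun m : 'X_{1..n} => m i))|_ /eqP].
  by rewrite !mnm1E eqxx; case: eqP.
by rewrite oner_eq0.
Qed.

Section ScaledPermutation.
Variables (w : 'S_n) (c d : 'I_n -> R) (cdK : forall i, c i * d i = 1).
Let u i : F := C (c i) * x (w i).
Let phi : {rmorphism {mpoly R[n]} -> F} := mmap C u.

(** The substitution X_i -> d_j X_j with j = w^-1(i) is a left inverse on polynomials, so no nonzero
    denominator is sent to 0. Permutations, q-shifts and pi^-1 are all of this scaled form. *)
Lemma mmap_scaled_perm_neq0 p : p != 0 -> mmap C u p != 0.
Proof.
pose s : {rmorphism _ -> _} :=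
  mmap (@mpolyC n R) (fun i => (c i)%:MP * 'X_(w i)).
pose s' : {rmorphism _ -> _} :=
  mmap (@mpolyC n R) (fun i => (d (w^-1%g i))%:MP * 'X_(w^-1%g i)).
have sK : s' \o s =1 idfun.
  apply: mpoly_rmorph_eq => [a|i] /=; first by rewrite !mmapC.
  rewrite mmapX mmap1U rmorphM /= mmapC mmapX mmap1U permK.
  by rewrite mulrA -mpolyCM cdK mul1r.
have -> : mmap C u p = FracField.tofrac (s p).
  rewrite -[LHS]/(phi p) -[RHS]/((emb \o s) p).
  apply: mpoly_rmorph_eq => [a|i] /=; first by rewrite !mmapC.
  by rewrite !mmapX !mmap1U rmorphM.
by rewrite ratf_poly_eq0; apply: contra_neq => sp0; rewrite -[p]sK /= sp0 rmorph0.
Qed.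

(** This frees [ratsubst] from the representative chosen by [repr]: phi preserves the equality of
    cross products and keeps denominators nonzero. *)
Lemma mmap_frac_eq p e p' e' : e != 0 -> e' != 0 ->
  emb p / emb e = emb p' / emb e' -> phi p / phi e = phi p' / phi e'.
Proof.
move=> e0 e'0 /eqP; rewrite eqr_div ?ratf_poly_eq0// -!(rmorphM emb).
rewrite tofrac_eq => /eqP/(congr1 phi); rewrite !rmorphM => E; apply/eqP.
by rewrite eqr_div ?mmap_scaled_perm_neq0// E.
Qed.

Lemma ratsubst_div p e : e != 0 -> ratsubst u (emb p / emb e) = phi p / phi e.
Proof.
move=> e0; apply: mmap_frac_eq => //; first exact: denom_ratioP.
by rewrite -ratf_numden.
Qed.

Lemma ratsubst_poly p : ratsubst u (emb p) = phi p.
Proof.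
by rewrite -[emb p]divr1 -(rmorph1 emb) ratsubst_div ?oner_neq0// rmorph1 divr1.
Qed.

Lemma ratsubst_zmod_morphism : zmod_morphism (ratsubst u).
Proof.
move=> f g; have [[p d0] /= d00 ->] := ratfP f.
have [[p' d'] /= d'0 ->] := ratfP g.
rewrite -mulNr addf_div ?ratf_poly_eq0// mulNr -!(rmorphM emb) -(rmorphB emb).
rewrite !ratsubst_div ?mulf_neq0// rmorphB !rmorphM -[in RHS]mulNr.
by rewrite addf_div ?mmap_scaled_perm_neq0// mulNr.
Qed.

Lemma ratsubst_monoid_morphism : monoid_morphism (ratsubst u).
Proof.
split=> [|f g]; first by rewrite -(rmorph1 emb) ratsubst_poly !rmorph1.
have [[p d0] /= d00 ->] := ratfP f; have [[p' d'] /= d'0 ->] := ratfP g.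
by rewrite mulf_div -!(rmorphM emb) !ratsubst_div ?mulf_neq0// !rmorphM mulf_div.
Qed.

Lemma ratsubstC a : ratsubst u (C a) = C a.
Proof. by rewrite -[C a]/(emb _) ratsubst_poly /= mmapC. Qed.

Lemma ratsubstX i : ratsubst u (x i) = u i.
Proof. by rewrite -[x i]/(emb _) ratsubst_poly /= mmapX mmap1U. Qed.

End ScaledPermutation.
End RationalSubstitution.

(** * Shift and permutation operators, their expansions and residues *)

Section Operators.
Variables (n : nat) (K : fieldType) (q : K) (q_neq0 : q != 0).
Local Notation F := (ratf n (Ctau K)).
Local Notation L := (laurent n (Ctau K)).
Local Notation x := (@ratX n (Ctau K)).
Local Notation C := (@ratC n (Ctau K)).
Local Notation key := ({ffun 'I_n -> int} * 'S_n)%type.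
Local Notation tpow := (@tpow n K q).
Local Notation tshift := (@tshift n K q).

Lemma permopE w :
  @permop n K w = ratsubst (fun i => C ((fun=> 1) i) * x (w i)).
Proof. by congr ratsubst; apply/funext => i; rewrite rmorph1 mul1r. Qed.

Lemma permop_zmod_morphism w : zmod_morphism (@permop n K w).
Proof. rewrite permopE; exact: ratsubst_zmod_morphism (fun=> mulr1 1). Qed.

Lemma permop_monoid_morphism w : monoid_morphism (@permop n K w).
Proof. rewrite permopE; exact: ratsubst_monoid_morphism (fun=> mulr1 1). Qed.

HB.instance Definition _ w := GRing.isZmodMorphism.Build F F (@permop n K w)
  (permop_zmod_morphism w).
HB.instance Definition _ w := GRing.isMonoidMorphism.Build F F (@permop n K w)
  (permop_monoid_morphism w).

Lemma permop_mul w f g : permop w (f * g) = permop w f * permop w g :> F.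
Proof. exact: rmorphM. Qed.

Lemma permop_sub w f g : permop w (f - g) = permop w f - permop w g :> F.
Proof. exact: rmorphB. Qed.

Lemma permop_add w f g : permop w (f + g) = permop w f + permop w g :> F.
Proof. exact: rmorphD. Qed.

Lemma permopV w f : permop w f^-1 = (permop w f)^-1 :> F.
Proof. exact: fmorphV. Qed.

Lemma permopC w c : permop w (C c) = C c.
Proof. rewrite permopE; exact: ratsubstC (fun=> mulr1 1) _. Qed.

Lemma permopX w i : permop w (x i) = x (w i).
Proof.
by rewrite permopE (ratsubstX w (fun=> mulr1 1)) rmorph1 mul1r.
Qed.

Lemma cst_expzK (e : int) : cst (q ^ e) * cst (q ^ - e) = 1 :> Ctau K.
Proof. by rewrite -rmorphM -expfzDr// subrr rmorph1. Qed.

Lemma tpowE k :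
  tpow k = ratsubst (fun i => C (cst (q ^ k i)) * x ((1 : 'S_n)%g i)).
Proof. by congr ratsubst; apply/funext => i; rewrite perm1. Qed.

Lemma tpow_zmod_morphism k : zmod_morphism (tpow k).
Proof. rewrite tpowE; exact: ratsubst_zmod_morphism (fun i => cst_expzK (k i)). Qed.

Lemma tpow_monoid_morphism k : monoid_morphism (tpow k).
Proof. rewrite tpowE; exact: ratsubst_monoid_morphism (fun i => cst_expzK (k i)). Qed.

HB.instance Definition _ k := GRing.isZmodMorphism.Build F F (tpow k)
  (tpow_zmod_morphism k).
HB.instance Definition _ k := GRing.isMonoidMorphism.Build F F (tpow k)
  (tpow_monoid_morphism k).

Definition tpow_rmorphism k : {rmorphism F -> F} := tpow k.

Lemma tpow_mul k f g : tpow k (f * g) = tpow k f * tpow k g.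
Proof. exact: rmorphM. Qed.

Lemma tpow_sub k f g : tpow k (f - g) = tpow k f - tpow k g.
Proof. exact: rmorphB. Qed.

Lemma tpowC k c : tpow k (C c) = C c.
Proof. rewrite tpowE; exact: ratsubstC (fun i => cst_expzK (k i)) _. Qed.

Lemma tpowX k i : tpow k (x i) = C (cst (q ^ k i)) * x i.
Proof. by rewrite tpowE (ratsubstX 1 (fun i => cst_expzK (k i))) perm1. Qed.

Lemma permop1 f : permop 1 f = f :> F.
Proof.
rewrite -[RHS]/(idfun f); apply: ratf_rmorph_eq => [c|i] /=.
  exact: permopC.
by rewrite permopX perm1.
Qed.

(** The order is reversed because [v * w] applies v first: X_i goes to X_{v(i)} and then to
    X_{w(v(i))}. *)
Lemma permopM w v f : permop w (permop v f) = permop (v * w) f :> F.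
Proof.
rewrite -[LHS]/((permop w \o permop v) f); apply: ratf_rmorph_eq => [c|i] /=.
  by rewrite !permopC.
by rewrite !permopX permM.
Qed.

Lemma tpow0 f : tpow 0 f = f.
Proof.
rewrite -[RHS]/(idfun f); apply: ratf_rmorph_eq => [c|i] /=.
  exact: tpowC.
by rewrite tpowX ffunE expr0z /cst !rmorph1 mul1r.
Qed.

Lemma tpowD k l f : tpow k (tpow l f) = tpow (k + l) f.
Proof.
rewrite -[LHS]/((tpow k \o tpow l) f); apply: ratf_rmorph_eq => [c|i] /=.
  by rewrite !tpowC.
rewrite !tpowX rmorphM /= tpowC tpowX ffunE expfzDr//.
by rewrite /cst !rmorphM /= mulrCA mulrA.
Qed.

Lemma permop_tpow w k f :
  permop w (tpow k f) = tpow [ffun i => k ((w^-1)%g i)] (permop w f).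
Proof.
rewrite -[LHS]/((permop w \o tpow k) f) -[RHS]/((tpow _ \o permop w) f).
apply: ratf_rmorph_eq => [c|i] /=; first by rewrite !(tpowC, permopC).
by rewrite tpowX rmorphM /= permopC !permopX tpowX ffunE permK.
Qed.

Lemma permop_tshift w i e f :
  permop w (tshift i e f) = tshift (w i) e (permop w f).
Proof.
rewrite /Defs.tshift permop_tpow; congr (tpow _ _); apply/ffunP => j.
by rewrite !ffunE (canF_eq (permKV w)).
Qed.

Lemma tshiftK i e f : tshift i (- e) (tshift i e f) = f.
Proof.
rewrite /Defs.tshift tpowD -[RHS]tpow0; congr (tpow _ _); apply/ffunP => j.
by rewrite !ffunE; case: eqP; rewrite ?addNr ?addr0.
Qed.

(** Expansions are lists in which a key may occur several times, so that adding operators is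
    concatenation. Repeated keys are merged only in [has_res_diffop]. *)
Definition evalop (s : seq (F * key)) (f : F) : F :=
  \sum_(e <- s) e.1 * tpow e.2.1 (permop e.2.2 f).

Definition evalres (s : seq (F * key)) (f : F) : F :=
  \sum_(e <- s) e.1 * tpow e.2.1 f.

(* A relation rather than a function of A: that B does not depend on the chosen
   expansion of A is only known through has_res_Res. *)
Definition has_res (A B : F -> F) : Prop :=
  exists s, A =1 evalop s /\ B =1 evalres s.

Lemma has_res_eq A B A' B' : has_res A B -> A =1 A' -> B =1 B' -> has_res A' B'.
Proof.
by move=> [s [As Bs]] AA' BB'; exists s; split=> f; rewrite -?AA' -?BB'.
Qed.

Lemma has_res_term g k w :
  has_res (fun f => g * tpow k (permop w f)) (fun f => g * tpow k f).
Proof.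
by exists [:: (g, (k, w))]; split=> f; rewrite /evalop /evalres big_seq1.
Qed.

Lemma has_res_id : has_res id id.
Proof.
apply: has_res_eq (has_res_term 1 0 1) _ _ => f /=.
  by rewrite mul1r tpow0 permop1.
by rewrite mul1r tpow0.
Qed.

Lemma has_res0 : has_res (fun=> 0) (fun=> 0).
Proof. by exists [::]; split=> f; rewrite /evalop /evalres big_nil. Qed.

Lemma has_resD A B A' B' : has_res A B -> has_res A' B' ->
  has_res (fun f => A f + A' f) (fun f => B f + B' f).
Proof.
move=> [s [As Bs]] [s' [As' Bs']]; exists (s ++ s').
by split=> f; rewrite /evalop /evalres big_cat /= ?As ?As' ?Bs ?Bs'.
Qed.

Lemma has_res_sum (I : Type) (r : seq I) (P : pred I) (A B : I -> F -> F) :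
  (forall i, P i -> has_res (A i) (B i)) ->
  has_res (fun f => \sum_(i <- r | P i) A i f) (fun f => \sum_(i <- r | P i) B i f).
Proof.
move=> AB; elim: r => [|i r IHr].
  by apply: has_res_eq has_res0 _ _ => f; rewrite big_nil.
case Pi: (P i); last by apply: has_res_eq IHr _ _ => f; rewrite big_cons Pi.
by apply: has_res_eq (has_resD (AB i Pi) IHr) _ _ => f; rewrite big_cons Pi.
Qed.

Lemma has_res_mull g A B : has_res A B ->
  has_res (fun f => g * A f) (fun f => g * B f).
Proof.
move=> [s [As Bs]].
have := @has_res_sum _ s predT _ _
  (fun e _ => has_res_term (g * e.1) e.2.1 e.2.2).
by move/has_res_eq; apply=> f; rewrite ?As ?Bs mulr_sumr;
   apply: eq_bigr => e _; rewrite mulrA.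
Qed.

(** Composition on the right leaves the coefficients of A alone, so it suffices to treat one t^k w
    at a time, provided the factor c does not depend on k and w. *)
Lemma has_res_compr (P : F -> F) c A B :
  (forall k w, has_res (fun f => tpow k (permop w (P f)))
                       (fun f => c * tpow k f)) ->
  has_res A B -> has_res (A \o P) (fun f => c * B f).
Proof.
move=> Pc [s [As Bs]].
have := @has_res_sum _ s predT _ _
  (fun e _ => has_res_mull e.1 (Pc e.2.1 e.2.2)).
move/has_res_eq; apply=> f; rewrite /= ?As// ?Bs.
by rewrite mulr_sumr; apply: eq_bigr => e _; rewrite mulrCA.
Qed.

(** v g t^k w = v(g) (v t^k v^-1) v w. Dropping the permutation v w leaves the conjugate by v of g
    t^k. *)
Lemma has_res_perml v A B : has_res A B ->
  has_res (permop v \o A) (permop v \o B \o permop v^-1%g).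
Proof.
move=> [s [As Bs]].
have := @has_res_sum _ s predT _ _ (fun e _ => has_res_term (permop v e.1)
  [ffun i => e.2.1 (v^-1%g i)] (e.2.2 * v)%g).
move/has_res_eq; apply=> f /=; rewrite ?As ?Bs rmorph_sum; apply: eq_bigr => e _.
  by rewrite /= permop_mul permop_tpow permopM.
by rewrite /= permop_mul permop_tpow permopM mulVg permop1.
Qed.

(** * Linear independence of the operators t^k w, and uniqueness of residues *)

Definition monomial_op (kw : key) (f : F) : F := tpow kw.1 (permop kw.2 f).

Lemma monomial_opM kw f g :
  monomial_op kw (f * g) = monomial_op kw f * monomial_op kw g.
Proof. by rewrite /monomial_op permop_mul tpow_mul. Qed.

Lemma monomial_op1 kw : monomial_op kw 1 = 1.
Proof. by rewrite /monomial_op !rmorph1. Qed.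

Hypothesis q_not_root1 : forall m : nat, (0 < m)%N -> q ^+ m != 1.

Lemma expz_inj : injective (fun e : int => q ^ e).
Proof.
have qn (m : nat) : q ^ m = 1 -> m = 0%N.
  by case: m => // m /eqP; rewrite -exprnP (negPf (q_not_root1 _)).
move=> d e /= qde; have: q ^ (d - e) = 1.
  by rewrite expfzDr// qde -expfzDr// subrr.
case: (intP (d - e)) (subrK e d) => [|m|m] de.
- by rewrite -de add0r.
- by move/qn.
- by rewrite -invr_expz => /(congr1 GRing.inv); rewrite invrK invr1 => /qn.
Qed.

(** The image of X_i is q^{k(w(i))} X_{w(i)}: its variable determines w, and its constant then
    determines k because the powers of q are distinct. *)
Lemma monomial_op_inj (k l : key) :
  (forall i, monomial_op k (x i) = monomial_op l (x i)) -> k = l.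
Proof.
have lin (c d : Ctau K) (i j : 'I_n) : c != 0 -> C c * x i = C d * x j ->
    i = j /\ c = d.
  move=> c0 E.
  have {E} : ratf_poly (c%:MP * 'X_i) = ratf_poly (d%:MP * 'X_j).
    by rewrite !rmorphM.
  move=> /eqP; rewrite tofrac_eq => /eqP.
  move=> /(congr1 (mcoeff U_(i)%MM)).
  rewrite !mcoeffCM !mcoeffX eqxx mulr1.
  case: eqP => [/(congr1 (fun m : 'X_{1..n} => m i))|_].
    by rewrite !mnm1E eqxx mulr1; case: eqP => [->|].
  by rewrite mulr0 => /eqP; rewrite (negPf c0).
case: k l => [k w] [l v] /= kl.
have qk0 e : cst (q ^ e) != 0 :> Ctau K.
  apply/eqP => /(congr1 (fun c => c * cst (q ^ - e))).
  by rewrite cst_expzK// mul0r => /eqP; rewrite oner_eq0.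
have kwlv i : w i = v i /\ cst (q ^ k (w i)) = cst (q ^ l (v i)) :> Ctau K.
  by move: (kl i); rewrite /monomial_op /= !permopX !tpowX; apply: lin.
have wv : w = v by apply/permP => i; case: (kwlv i).
rewrite -{}wv in kwlv *; congr (_, _); apply/ffunP => i.
apply: expz_inj; have [_] := kwlv (w^-1 i)%g; rewrite permKV.
move=> /(congr1 val)/eqP; rewrite tofrac_eq => /eqP.
by move=> /(congr1 (mcoeff 0%MM)); rewrite !mcoeffC eqxx !mulr1.
Qed.

(* Dedekind: pick X_i on which k and the head k0 differ, and subtract
   k0(X_i) times the relation at f from the relation at X_i f. *)
Lemma monomial_op_free (s : seq key) (g : key -> F) : uniq s ->
  (forall f : L, \sum_(k <- s) g k * monomial_op k f = 0) ->
  forall k, k \in s -> g k = 0.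
Proof.
have [m] := ubnP (size s); elim: m => // m IHm in s g *.
case: s => // k0 s /= sm /andP[k0s us] s0.
have gs0 k : k \in s -> g k = 0.
  move=> ks; have k0k : k0 != k by apply: contraNneq k0s => ->.
  have [i ki] : exists i, monomial_op k (x i) != monomial_op k0 (x i).
    apply/not_existsP => eqk; move/eqP: k0k; apply.
    apply: monomial_op_inj => i; apply/eqP; rewrite eq_sym.
    by apply/negPn/negP/eqk.
  suff /eqP: g k * (monomial_op k (x i) - monomial_op k0 (x i)) = 0.
    by rewrite mulf_eq0 subr_eq0 (negPf ki) orbF => /eqP.
  apply: (IHm s (fun k => g k * (monomial_op k (x i) - monomial_op k0 (x i)))) ks => //.
  move=> f; have := s0 (laurentX (Ctau K) i * f); have := s0 f.
  rewrite !big_cons => s0f s0xf.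
  under eq_bigr do rewrite mulrBr mulrBl.
  rewrite sumrB; apply/eqP; rewrite subr_eq0; apply/eqP.
  transitivity (- (g k0 * monomial_op k0 (x i * val f))).
    apply/eqP; rewrite -addr_eq0 addrC -[X in _ == X]s0xf; apply/eqP.
    congr (_ + _); apply: eq_bigr => l _.
    by rewrite -mulrA -monomial_opM.
  transitivity (monomial_op k0 (x i) * \sum_(j <- s) g j * monomial_op j (val f)).
    have -> : \sum_(j <- s) g j * monomial_op j (val f) = - (g k0 * monomial_op k0 (val f)).
      by apply/eqP; rewrite -addr_eq0 addrC s0f.
    by rewrite monomial_opM mulrN mulrCA.
  by rewrite mulr_sumr; apply: eq_bigr => l _; rewrite mulrCA mulrA.
move=> k; rewrite inE => /orP[/eqP->|/gs0//].
(* With the tail coefficients known to vanish, the relation at f = 1 reads g k0 = 0. *)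
have := s0 1; rewrite big_cons big_seq big1 => [|l /gs0->]; last by rewrite mul0r.
by rewrite addr0 monomial_op1 mulr1.
Qed.

(** Entries with the same key are merged by adding their coefficients. The identity [gE] serves
    twice: h is the operator t^k w for A and the bare shift t^k for B. *)
Lemma has_res_diffop A B : has_res A B ->
  exists g : diffop n K,
    A =1 (fun f => \sum_(k <- finsupp g) g k * monomial_op k f) /\
    B =1 (fun f => \sum_(k <- finsupp g) g k * tpow k.1 f).
Proof.
move=> [s [As Bs]].
pose S := [fset e.2 | e in s]%fset.
pose G k := \sum_(e <- s | e.2 == k) e.1.
pose g : diffop n K := [fsfun k in S => G k].
have gE (h : key -> F) :
    \sum_(e <- s) e.1 * h e.2 = \sum_(k <- finsupp g) g k * h k.
  (* The support of g may be smaller than S, since merged coefficients can cancel. *)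
  have -> : \sum_(k <- finsupp g) g k * h k = \sum_(k <- S) g k * h k.
    apply: big_fset_incl; first exact: finsupp_sub.
    by move=> k _ kg; rewrite fsfun_dflt ?mul0r.
  transitivity (\sum_(k <- S) \sum_(e <- s | e.2 == k) e.1 * h e.2).
    rewrite (exchange_big_dep predT) //= big_seq [RHS]big_seq.
    apply: eq_bigr => e es.
    have eS : e.2 \in S by apply/imfsetP; exists e.
    rewrite big_mkcond (bigD1_seq e.2) ?fset_uniq//= eqxx big1 ?addr0// => k.
    by rewrite eq_sym => /negPf->.
  rewrite big_seq [RHS]big_seq; apply: eq_bigr => k kS.
  by rewrite fsfunE kS mulr_suml; apply: eq_bigr => e /eqP->.
by exists g; split=> f; rewrite ?As ?Bs -gE.
Qed.

(** An expansion of A' exists, so the one selected by [xget] is also an expansion. Their difference,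
    taken over the union of the supports, vanishes on all Laurent polynomials, and independence
    makes the two equal. *)
Lemma has_res_Res A B (A' : L -> L) : has_res A B ->
  (forall f : L, A' f = A f :> F) -> Res q A' =1 B.
Proof.
move=> /has_res_diffop[g [Ag Bg]] AA f; rewrite Bg /Res.
have gA : acts_as q A' g by move=> h; rewrite AA Ag.
set g' := xget _ _.
have g'A : acts_as q A' g' by exact: (xgetPex [fsfun] (ex_intro _ g gA)).
have -> // : g' = g.
apply/fsfunP => k.
have [kS|] := boolP (k \in (finsupp g `|` finsupp g')%fset); last first.
  by rewrite inE negb_or => /andP[kg kg']; rewrite !fsfun_dflt.
have ext (d : diffop n K) h : (finsupp d `<=` finsupp g `|` finsupp g')%fset ->
    \sum_(k <- finsupp d) d k * monomial_op k h =
    \sum_(k <- (finsupp g `|` finsupp g')%fset) d k * monomial_op k h.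
  move=> dS; apply: big_fset_incl => // l _ ld.
  by rewrite fsfun_dflt ?mul0r.
apply/eqP; rewrite -subr_eq0; apply/eqP.
apply: (@monomial_op_free _ (fun k => g' k - g k) (fset_uniq _) _ k kS) => h.
under eq_bigr do rewrite mulrBl.
rewrite sumrB -!ext ?fsubsetUl ?fsubsetUr//.
by rewrite -[X in X - _]g'A -[X in _ - X]gA subrr.
Qed.

End Operators.

(** * Closed forms of the residue coefficients, their recursions and sums *)

Section HeckeCoefficients.
Variables (n : nat) (F : fieldType) (t : F).
Implicit Types (x : 'I_n -> F) (i j l : 'I_n) (k : 'I_n.-1).

(** A rank-one factor of the Macdonald c-function, equal to t^-1 (t^2 x_i - x_j) / (x_i - x_j). *)
Definition hfactor x i j : F := (t * x i - t^-1 * x j) / (x i - x j).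

(* The coefficient of t_j in Res(T_i ... T_{n-1} X_n^{-1} pi^{-1}), in the
   1-based numbering of the paper. *)
Definition coef_up x i j : F :=
  (if (j < i)%N then 0 else
   if j == i then (x i)^-1 else (t - t^-1) / (x j - x i)) *
  \prod_(l < n | (i < l)%N && (l != j)) hfactor x j l.

(* The coefficient of t_j^{-1} in Res(T_{i-1} ... T_1 pi). *)
Definition coef_down x i j : F :=
  (if (i < j)%N then 0 else
   if j == i then 1 else (t^-1 - t) * x i / (x j - x i)) *
  \prod_(l < n | (l < i)%N && (l != j)) hfactor x l j.

(** The function h_k in T_k = (t + h_k) s_k - h_k. *)
Definition hecke_coef x k : F :=
  (t - t^-1) * x (idxS k) / (x (idx k) - x (idxS k)).

Hypothesis t_neq0 : t != 0.

Section Injective.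
Variables (x : 'I_n -> F).
Hypotheses (x_inj : injective x) (x_neq0 : forall i, x i != 0).

Let subx_neq0 i j : i != j -> x i - x j != 0.
Proof. by move=> ij; rewrite subr_eq0 (inj_eq x_inj). Qed.

Lemma prod_hfactor_gtS (y : 'I_n -> F) i k :
  \prod_(l < n | (k < l)%N && (l != i)) hfactor y i l =
  (if i == idxS k then 1 else hfactor y i (idxS k)) *
  \prod_(l < n | (k.+1 < l)%N && (l != i)) hfactor y i l.
Proof.
case: eqP => [->|/eqP iS].
  by rewrite mul1r; apply: eq_bigl => l; rewrite -val_eqE /=; lia.
rewrite (bigD1 (idxS k)) /=; last by rewrite ltnSn eq_sym.
by congr (_ * _); apply: eq_bigl => l; rewrite -!val_eqE /=; lia.
Qed.

Lemma prod_hfactor_ltS (y : 'I_n -> F) i k :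
  \prod_(l < n | (l < k.+1)%N && (l != i)) hfactor y l i =
  (if i == idx k then 1 else hfactor y (idx k) i) *
  \prod_(l < n | (l < k)%N && (l != i)) hfactor y l i.
Proof.
case: eqP => [->|/eqP iS].
  by rewrite mul1r; apply: eq_bigl => l; rewrite -val_eqE /=; lia.
rewrite (bigD1 (idx k)) /=; last by rewrite ltnSn eq_sym.
by congr (_ * _); apply: eq_bigl => l; rewrite -!val_eqE /=; lia.
Qed.

(** If the coefficients at k+1 are those of Res(A), the left side is the coefficient of t_j in
    Res(T_k A). The swap s_k preserves the product over l > k+1, so what remains is an identity in
    X_k, X_{k+1} and X_j, checked for j = k, for j = k+1 and for other j. *)
Lemma coef_up_step k j (s := tperm (idx k) (idxS k)) :
  (t + hecke_coef x k) * coef_up (x \o s) (idxS k) (s j)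
    - hecke_coef x k * coef_up x (idxS k) j = coef_up x (idx k) j.
Proof.
have kS : idx k != idxS k by rewrite -val_eqE /= neq_ltn ltnSn.
have abk := subx_neq0 kS.
have sK l : (k.+1 < l)%N -> s l = l.
  by move=> kl; rewrite tpermD// -val_eqE /=; lia.
have sP i : \prod_(l < n | (k.+1 < l)%N && (l != s i)) hfactor (x \o s) (s i) l =
            \prod_(l < n | (k.+1 < l)%N && (l != i)) hfactor x i l.
  rewrite (eq_bigl (fun l => (k.+1 < l)%N && (l != i))) => [|l].
    by apply: eq_bigr => l /andP[/sK + _]; rewrite /hfactor /= tpermK => ->.
  case: ltnP => //= /sK sl; congr (~~ _).
  by rewrite -{1}sl (inj_eq perm_inj).
rewrite /coef_up /= sP prod_hfactor_gtS /hecke_coef /hfactor /= tpermK.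
have [->|jk] := eqVneq j (idx k).
  rewrite tpermL !eqxx (negPf kS) ltnn ltnSn /= tpermR ltnn.
  move: (\prod_(l < n | _) _) (x_neq0 (idx k)) (x_neq0 (idxS k)) => P a0 b0.
  by field; rewrite abk t_neq0.
have [->|jS] := eqVneq j (idxS k).
  rewrite tpermR (negPf kS) /= ltnn ltnSn ltnNge leqnSn /=.
  have := subx_neq0 (i := idxS k) (j := idx k); rewrite eq_sym => /(_ kS) bak.
  move: (\prod_(l < n | _) _) (x_neq0 (idx k)) (x_neq0 (idxS k)) => P a0 b0.
  by field; rewrite abk bak ?b0 ?t_neq0.
have -> : s j = j by rewrite tpermD// eq_sym.
(* As j differs from k, the conditions j < k+1 and j < k agree, so both sides vanish together. *)
rewrite (negPf jS) tpermR ltnS leq_eqVlt -[j == k :> nat]/(j == idx k) (negPf jk) /=.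
case: ifP => [_|_]; first by rewrite !mul0r !mulr0 subr0.
move: (\prod_(l < n | _) _) (subx_neq0 jk) (subx_neq0 jS) => P a0 b0.
by field; rewrite abk a0 b0 t_neq0.
Qed.

(** The mirror case: T_k raises the index from k to k+1, and the common factor is the product over l
    < k. *)
Lemma coef_down_step k j (s := tperm (idx k) (idxS k)) :
  (t + hecke_coef x k) * coef_down (x \o s) (idx k) (s j)
    - hecke_coef x k * coef_down x (idx k) j = coef_down x (idxS k) j.
Proof.
have kS : idx k != idxS k by rewrite -val_eqE /= neq_ltn ltnSn.
have abk := subx_neq0 kS.
have sK l : (l < k)%N -> s l = l.
  by move=> kl; rewrite tpermD// -val_eqE /=; lia.
have sP i : \prod_(l < n | (l < k)%N && (l != s i)) hfactor (x \o s) l (s i) =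
            \prod_(l < n | (l < k)%N && (l != i)) hfactor x l i.
  rewrite (eq_bigl (fun l => (l < k)%N && (l != i))) => [|l].
    by apply: eq_bigr => l /andP[/sK + _]; rewrite /hfactor /= tpermK => ->.
  case: ltnP => //= /sK sl; congr (~~ _).
  by rewrite -{1}sl (inj_eq perm_inj).
rewrite /coef_down /= sP prod_hfactor_ltS /hecke_coef /hfactor /= tpermK.
have [->|jk] := eqVneq j (idxS k).
  rewrite tpermR !eqxx [idxS k == _]eq_sym (negPf kS) ltnn ltnSn /= ltnn.
  move: (\prod_(l < n | _) _) (x_neq0 (idx k)) (x_neq0 (idxS k)) => P a0 b0.
  by field; rewrite abk t_neq0.
have [->|jS] := eqVneq j (idx k).
  rewrite tpermL [idxS k == _]eq_sym (negPf kS) /= ltnn ltnSn ltnNge leqnSn /=.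
  move: (\prod_(l < n | _) _) (x_neq0 (idx k)) (x_neq0 (idxS k)) => P a0 b0.
  by field; rewrite abk ?b0 t_neq0.
have -> : s j = j by rewrite tpermD// eq_sym.
rewrite (negPf jS) tpermL.
have -> : (k.+1 < j)%N = (k < j)%N.
  by move: jk; rewrite -val_eqE /=; lia.
case: ifP => [_|_]; first by rewrite !mul0r !mulr0 subr0.
have := subx_neq0 jS; have := subx_neq0 jk.
have : x (idx k) - x j != 0 by rewrite subx_neq0// eq_sym.
move: (\prod_(l < n | _) _) => P b0' a0 b0.
by field; rewrite abk a0 b0 ?b0' ?t_neq0.
Qed.

(** The sum telescopes: E m is its part with i >= m, which is 0 for m > j. For i < j the step is
    hfactor x j i - t^-1 = (t - t^-1) x_j / (x_j - x_i). *)
Lemma coef_up_sum j :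
  \sum_(i < n) t ^- i * coef_up x i j =
  (x j)^-1 * \prod_(l < n | l != j) hfactor x j l.
Proof.
pose E m := if (m <= j)%N then
  t ^- m * (x j)^-1 * \prod_(l < n | (m <= l)%N && (l != j)) hfactor x j l else 0.
have step (i : 'I_n) : t ^- i * coef_up x i j = E i - E i.+1.
  rewrite /E /coef_up; have [ij|ji|/val_inj <-] := ltngtP i j; last first.
  - rewrite eqxx subr0 mulrA; congr (_ * _); apply: eq_bigl => l.
    by rewrite -!val_eqE /=; lia.
  - by rewrite mul0r mulr0 subrr.
  have ij' : i != j by rewrite -val_eqE /=; lia.
  have ji' : x j - x i != 0 by rewrite subx_neq0// eq_sym.
  rewrite eq_sym (negPf ij') [\prod_(l < n | (i <= l)%N && _) _](bigD1 i) /=; last first.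
    by rewrite leqnn.
  have -> : \prod_(l < n | (i <= l)%N && (l != j) && (l != i)) hfactor x j l =
            \prod_(l < n | (i < l)%N && (l != j)) hfactor x j l.
    by apply: eq_bigl => l; rewrite -!val_eqE /=; lia.
  move: (\prod_(l < n | _) _) (x_neq0 j) => P j0.
  rewrite /hfactor exprS invfM; move: (t ^- i) => T.
  by field; rewrite j0 ji' t_neq0.
rewrite (eq_bigr (fun i : 'I_n => E i - E i.+1)) => [|i _]; last exact: step.
rewrite -(big_mkord xpredT (fun m => E m - E m.+1)).
(* The differences E i - E (i+1) are negated to fit [telescope_sumr]. *)
rewrite -[LHS]opprK -sumrN; under eq_bigr do rewrite opprB.
rewrite telescope_sumr// opprB /E leq0n [(n <= j)%N]leqNgt ltn_ord subr0.
by rewrite expr0 invr1 mul1r.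
Qed.

(** Here E m is the part of the sum with i < m, so E 0 = 0 and E n is the whole. For i > j the step
    is hfactor x i j - t = (t - t^-1) x_j / (x_i - x_j). *)
Lemma coef_down_sum j :
  \sum_(i < n) t ^+ (n - i.+1) * ((x i)^-1 * coef_down x i j) =
  (x j)^-1 * \prod_(l < n | l != j) hfactor x l j.
Proof.
pose E m := if (j < m)%N then
  t ^+ (n - m) * (x j)^-1 * \prod_(l < n | (l < m)%N && (l != j)) hfactor x l j else 0.
have step (i : 'I_n) :
    t ^+ (n - i.+1) * ((x i)^-1 * coef_down x i j) = E i.+1 - E i.
  rewrite /E /coef_down ltnS; have [ij|ji|/val_inj <-] := ltngtP i j; last first.
  - rewrite eqxx subr0 mul1r mulrA; congr (_ * _); apply: eq_bigl => l.
    by rewrite -!val_eqE /=; lia.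
  - have ij' : i != j by rewrite -val_eqE /=; lia.
    have ji' : x j - x i != 0 by rewrite subx_neq0// eq_sym.
    have ji2 : x i - x j != 0 by rewrite subx_neq0.
    rewrite eq_sym (negPf ij') [\prod_(l < n | (l < i.+1)%N && _) _](bigD1 i) /=; last first.
      by rewrite leqnn.
    have -> : \prod_(l < n | (l < i.+1)%N && (l != j) && (l != i)) hfactor x l j =
              \prod_(l < n | (l < i)%N && (l != j)) hfactor x l j.
      by apply: eq_bigl => l; rewrite -!val_eqE /=; lia.
    (* The exponent n - i of E i exceeds n - (i+1) by one; this yields the t subtracted from hfactor
       x i j. *)
    rewrite -(subnSK (ltn_ord i)) exprS.
    move: (\prod_(l < n | _) _) (x_neq0 j) (x_neq0 i) => P j0 i0.
    rewrite /hfactor; move: (t ^+ (n - i.+1)) => T.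
    by field; rewrite j0 i0 ji' ji2 t_neq0.
  by rewrite mul0r !mulr0 subrr.
rewrite (eq_bigr (fun i : 'I_n => E i.+1 - E i)) => [|i _]; last exact: step.
rewrite -(big_mkord xpredT (fun m => E m.+1 - E m)).
rewrite telescope_sumr// /E /= ltn_ord subnn expr0 mul1r subr0.
by congr (_ * _); apply: eq_bigl => l; rewrite ltn_ord.
Qed.

Lemma prod_hfactor_l j :
  \prod_(l < n | l != j) hfactor x j l =
  t ^- n.-1 * \prod_(l < n | l != j) ((t ^+ 2 * x j - x l) / (x j - x l)).
Proof.
have -> : t ^- n.-1 = \prod_(l < n | l != j) t^-1.
  by rewrite prodr_const cardC1 card_ord exprVn.
rewrite -big_split; apply: eq_bigr => l lj /=; rewrite /hfactor.
have : x j - x l != 0 by rewrite subx_neq0// eq_sym.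
by move=> jl; field; rewrite jl t_neq0.
Qed.

Lemma prod_hfactor_r j :
  \prod_(l < n | l != j) hfactor x l j =
  t ^- n.-1 * \prod_(l < n | l != j) ((x j - t ^+ 2 * x l) / (x j - x l)).
Proof.
have -> : t ^- n.-1 = \prod_(l < n | l != j) t^-1.
  by rewrite prodr_const cardC1 card_ord exprVn.
rewrite -big_split; apply: eq_bigr => l lj /=; rewrite /hfactor.
have : x j - x l != 0 by rewrite subx_neq0// eq_sym.
have : x l - x j != 0 by rewrite subx_neq0.
by move=> lj' jl; field; rewrite jl lj' t_neq0.
Qed.

(** The weight t^-i is the contribution of the i inverse Hecke generators to the right of pi^-1 in
    D_i. *)
Lemma sum_coef_up (T : 'I_n -> F) :
  \sum_(i < n) t ^- i * (\sum_(j < n) coef_up x i j * T j) =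
  t ^- n.-1 * \sum_(i < n) (x i)^-1 *
    (\prod_(j < n | j != i) ((t ^+ 2 * x i - x j) / (x i - x j))) * T i.
Proof.
under eq_bigr do rewrite mulr_sumr.
rewrite exchange_big mulr_sumr; apply: eq_bigr => j _ /=.
under eq_bigr do rewrite mulrA.
by rewrite -mulr_suml coef_up_sum prod_hfactor_l !mulrA (mulrC (x j)^-1).
Qed.

(** The weight is the contribution of the n-1-i Hecke generators to the right of pi in D_i. *)
Lemma sum_coef_down (T : 'I_n -> F) :
  \sum_(i < n) t ^+ (n - i.+1) * ((x i)^-1 * \sum_(j < n) coef_down x i j * T j) =
  t ^- n.-1 * \sum_(i < n) (x i)^-1 *
    (\prod_(j < n | j != i) ((x i - t ^+ 2 * x j) / (x i - x j))) * T i.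
Proof.
under eq_bigr do rewrite mulrA mulr_sumr.
rewrite exchange_big mulr_sumr; apply: eq_bigr => j _ /=.
under eq_bigr do rewrite mulrA -(mulrA (_ ^+ _)).
by rewrite -mulr_suml coef_down_sum prod_hfactor_r !mulrA (mulrC (x j)^-1).
Qed.

End Injective.
End HeckeCoefficients.

(** * Field morphisms applied to the coefficients *)

Section HeckeMorphism.
Variables (n : nat) (F G : fieldType) (s : {rmorphism F -> G}) (t : F).
Variables (x : 'I_n -> F).

Lemma rmorph_hfactor i j :
  s (hfactor t x i j) = hfactor (s t) (s \o x) i j.
Proof. by rewrite fmorph_div !rmorphB !rmorphM fmorphV. Qed.

Lemma rmorph_coef_up i j : s (coef_up t x i j) = coef_up (s t) (s \o x) i j.
Proof.
rewrite rmorphM rmorph_prod; congr (_ * _).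
  case: ifP => _; first exact: rmorph0.
  case: ifP => _; first exact: fmorphV.
  by rewrite fmorph_div !rmorphB fmorphV.
by apply: eq_bigr => l _; exact: rmorph_hfactor.
Qed.

Lemma rmorph_coef_down i j :
  s (coef_down t x i j) = coef_down (s t) (s \o x) i j.
Proof.
rewrite rmorphM rmorph_prod; congr (_ * _).
  case: ifP => _; first exact: rmorph0.
  case: ifP => _; first exact: rmorph1.
  by rewrite fmorph_div rmorphM !rmorphB fmorphV.
by apply: eq_bigr => l _; exact: rmorph_hfactor.
Qed.

Lemma rmorph_hecke_coef k :
  s (hecke_coef t x k) = hecke_coef (s t) (s \o x) k.
Proof. by rewrite fmorph_div rmorphM !rmorphB fmorphV. Qed.

End HeckeMorphism.

(** * Rank-one identities for the Demazure-Lusztig operator *)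

(* The local T is T_k on u = f and v = s_k f, with a = X_k, b = X_{k+1}. *)
Section HeckeIdentities.
Variables (F : fieldType) (t a b : F).
Hypotheses (t_neq0 : t != 0) (a_neq0 : a != 0) (b_neq0 : b != 0).
Hypothesis ab : a != b.
Local Notation d := (t - t^-1).
Local Notation H c e := (d * e / (c - e)).
Local Notation T c e u v := ((t + H c e) * v - H c e * u).

Let ab0 : a - b != 0. Proof. by rewrite subr_eq0. Qed.
Let ba0 : b - a != 0. Proof. by rewrite subr_eq0 eq_sym. Qed.

(** Since a/b - 1 = (a - b)/b, the coefficient of s_k - 1 is d b / (a - b), that is h_k. *)
Lemma demazure_lusztigE u v :
  t * v + d / (a * b^-1 - 1) * (v - u) = T a b u v.
Proof.
have c0 : a / b - 1 != 0 by rewrite subr_eq0 -(inj_eq (mulIf b_neq0)) divfK// mul1r.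
by field; rewrite ab0 t_neq0 b_neq0.
Qed.

(** The argument [T b a v u] is s_k(T_k f), as s_k exchanges a with b and u with v. The identity is
    the quadratic relation, which makes [opTV] inverse to [opT]. *)
Lemma hecke_quadratic u v :
  T a b (T a b u v) (T b a v u) = d * T a b u v + u.
Proof. by field; rewrite ab0 ba0 t_neq0. Qed.

(** This is T_k X_{k+1}^-1 T_k = X_k^-1. *)
Lemma hecke_conj_inv u v :
  T a b (b^-1 * T a b u v) (a^-1 * T b a v u) = a^-1 * u.
Proof. by field; rewrite a_neq0 b_neq0 ab0 ba0 t_neq0. Qed.

End HeckeIdentities.

(** * The parameter tau in the field of rational functions *)

Section HeckeParameter.
Variables (n : nat) (K : fieldType).
Local Notation C := (@ratC n (Ctau K)).
Local Notation t := (C tau).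

(** A non-unit of [Ctau] is its own inverse by convention, so tau^-1 is known to map to 1/tau only
    once tau is a unit. *)
Lemma tau_unit : (tau : Ctau K) \is a GRing.unit.
Proof.
apply/andP; split; first exact: ratX_neq0.
apply/laurent_predP; exists 1, U_(ord0)%MM.
by rewrite tofrac1 div1r.
Qed.

Lemma ratC_tau_neq0 : t != 0.
Proof. by rewrite -unitfE; exact: (rmorph_unit C tau_unit). Qed.

Lemma ratC_tauB : C (tau - tau^-1) = t - t^-1.
Proof. by rewrite (rmorphB C) (rmorphV C tau_unit). Qed.

Lemma ratC_mul_tau_expz e : (0 < n)%N ->
  C (e * tau ^ (1 - n%:Z)) = C e * C tau ^- n.-1.
Proof.
move=> n_gt0; have -> : 1 - n%:Z = - n.-1%:Z by lia.
by rewrite (rmorphM C) -exprnN (rmorphV C) ?unitrX ?tau_unit// (rmorphXn C).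
Qed.

Lemma ratC_tau_sq : C (tau ^+ 2) = C tau ^+ 2.
Proof. exact: rmorphXn. Qed.

End HeckeParameter.

(** * Hecke operators and their effect on residues *)

Section HeckeOperators.
Variables (n : nat) (K : fieldType) (q : K) (q_neq0 : q != 0).
Local Notation F := (ratf n (Ctau K)).
Local Notation x := (@ratX n (Ctau K)).
Local Notation C := (@ratC n (Ctau K)).
Local Notation t := (C tau).
Local Notation tpow := (@tpow n K q).
Local Notation has_res := (@has_res n K q).
Local Notation sk k := (tperm (idx k) (idxS k)).
Local Notation hc := (hecke_coef t x).

Lemma idx_neqS (k : 'I_n.-1) : idx k != idxS k.
Proof. by rewrite -val_eqE /= neq_ltn ltnSn. Qed.

Lemma ratX_idx_neqS (k : 'I_n.-1) : x (idx k) != x (idxS k).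
Proof. by rewrite (inj_eq (@ratX_inj _ _)) idx_neqS. Qed.

Lemma opTE k (f : F) : opT k f = (t + hc k) * permop (sk k) f - hc k * f.
Proof.
rewrite /opT ratC_tauB.
rewrite /hecke_coef.
by rewrite (demazure_lusztigE (ratC_tau_neq0 n K) (ratX_neq0 _ _) (ratX_idx_neqS k)).
Qed.

Lemma permop_opT k (f : F) : let h := hecke_coef t (x \o sk k) k in
  permop (sk k) (opT k f) = (t + h) * f - h * permop (sk k) f.
Proof.
have E : permop (sk k) (hc k) = hecke_coef t (x \o sk k) k.
  have /= := rmorph_hecke_coef (permop (sk k)) t x k; rewrite permopC => ->.
  by congr hecke_coef; apply/funext => i; exact: permopX.
rewrite /= opTE permop_sub (permop_mul _ (t + hc k)) (permop_mul _ (hc k)).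
rewrite permop_add E permopC permopM tperm2.
by rewrite permop1.
Qed.

Lemma opT_opT k (f : F) : opT k (opT k f) = (t - t^-1) * opT k f + f.
Proof.
rewrite [LHS]opTE permop_opT /hecke_coef /= tpermL tpermR.
have /= E := hecke_quadratic (ratC_tau_neq0 n K) (ratX_idx_neqS k) f (permop (sk k) f).
by rewrite opTE /hecke_coef E.
Qed.

Lemma opT_ratX_conj k (f : F) :
  opT k ((x (idxS k))^-1 * opT k f) = (x (idx k))^-1 * f.
Proof.
rewrite [LHS]opTE (permop_mul _ (x _)^-1) permopV permopX tpermR permop_opT.
rewrite opTE /hecke_coef /= tpermL tpermR.
exact: (hecke_conj_inv (ratC_tau_neq0 n K) (ratX_neq0 _ _) (ratX_neq0 _ _) (ratX_idx_neqS k)).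
Qed.

Lemma opT_add k (f g : F) : opT k (f + g) = opT k f + opT k g.
Proof. by rewrite !opTE permop_add !mulrDr opprD addrACA. Qed.

Lemma opT_scale k c (f : F) : opT k (C c * f) = C c * opT k f.
Proof.
by rewrite !opTE (permop_mul _ (C c)) permopC mulrBr; congr (_ - _); exact: mulrCA.
Qed.

(** On the left T_k does more than rescale: its s_k conjugates the residue of A, while h_k only
    multiplies. *)
Lemma has_res_opT_l k A B : has_res A B ->
  has_res (fun f => opT k (A f))
    (fun f => (t + hc k) * permop (sk k) (B (permop (sk k) f)) - hc k * B f).
Proof.
move=> AB; have AB' := has_res_mull (t + hc k) (has_res_perml q_neq0 (sk k) AB).
apply: has_res_eq (has_resD AB' (has_res_mull (- hc k) AB)) _ _ => f /=.
  by rewrite opTE mulNr.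
by rewrite tpermV mulNr.
Qed.

Lemma opT_sub k (f g : F) : opT k (f - g) = opT k f - opT k g.
Proof. by apply: (canRL (addrK _)); rewrite -opT_add subrK. Qed.

Lemma opTTV k (f : F) : opTV k (opT k f) = f.
Proof. by rewrite /opTV ratC_tauB opT_opT addrC addKr. Qed.

Lemma opTVT k (f : F) : opT k (opTV k f) = f.
Proof. by rewrite /opTV opT_sub opT_scale ratC_tauB opT_opT addrC addKr. Qed.

(** Dropping s_k turns u s_k - v into u - v. Being constant, this is fixed by every t^l w and comes
    out as a factor. *)
Lemma has_res_swap_r k (u v : F) c P A B :
  (forall f, P f = u * permop (sk k) f - v * f) -> u - v = C c ->
  has_res A B -> has_res (fun f => A (P f)) (fun f => C c * B f).
Proof.
move=> PE uvc; apply: (has_res_compr (P := P) (c := C c)) => l w.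
pose g a := tpow l (permop w a).
have := has_resD (has_res_term q (g u) l (sk k * w)) (has_res_term q (- g v) l w).
move/has_res_eq; apply=> f /=.
  rewrite PE permop_sub (permop_mul _ u) (permop_mul _ v) tpow_sub//.
  rewrite (tpow_mul q_neq0 _ (permop w u)) (tpow_mul q_neq0 _ (permop w v)).
  by rewrite permopM mulNr.
by rewrite -mulrDl /g -tpow_sub// -permop_sub uvc permopC tpowC.
Qed.

Lemma has_res_opT_r k A B : has_res A B ->
  has_res (fun f => A (opT k f)) (fun f => t * B f).
Proof. by apply: has_res_swap_r (opTE k) _; rewrite addrK. Qed.

Lemma has_res_opTV_r k A B : has_res A B ->
  has_res (fun f => A (opTV k f)) (fun f => t^-1 * B f).
Proof.
rewrite -(rmorphV C (tau_unit K)).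
apply: (has_res_swap_r (u := t + hc k) (v := hc k + (t - t^-1)) (k := k)) => [f|].
  by rewrite /opTV ratC_tauB opTE [(hc k + _) * f]mulrDl opprD addrA.
rewrite (rmorphV C (tau_unit K)) opprD addrA addrK opprB addrCA subrr addr0.
by [].
Qed.

Lemma has_res_opT_rs (s : seq 'I_n.-1) A B : has_res A B ->
  has_res (fun f => A (foldr (@opT n K) f s)) (fun f => t ^+ size s * B f).
Proof.
elim: s A B => [|k s IHs] A B AB /=.
  by apply: has_res_eq AB _ _ => f //=; rewrite mul1r.
by have /has_res_eq := IHs _ _ (has_res_opT_r k AB); apply=> f //=;
  rewrite exprSr mulrA.
Qed.

Lemma has_res_opTV_rs (s : seq 'I_n.-1) A B : has_res A B ->
  has_res (fun f => A (foldr (@opTV n K) f s)) (fun f => t ^- size s * B f).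
Proof.
elim: s A B => [|k s IHs] A B AB /=.
  by apply: has_res_eq AB _ _ => f //=; rewrite invr1 mul1r.
by have /has_res_eq := IHs _ _ (has_res_opTV_r k AB); apply=> f //=;
  rewrite exprS invfM mulrCA mulrA.
Qed.

End HeckeOperators.

(** * Initial and final segments of the indices of the Hecke generators *)

Section OrdinalIntervals.
Variable p : nat.

(** These are the filter expressions of [opY], so its index lists are convertible to them. *)
Definition ord_lt m := [seq k : 'I_p <- enum 'I_p | (k < m)%N].
Definition ord_ge m := [seq k : 'I_p <- enum 'I_p | (m <= k)%N].

(** Under the injection [val] the segments become intervals of natural numbers, where equalities of
    lists are easy to check. *)
Lemma map_ord_lt m : (m <= p)%N -> map val (ord_lt m) = iota 0 m.
Proof.
move=> mp; rewrite /ord_lt -(filter_map val (fun a => a < m)%N) val_enum_ord.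
rewrite -(subnKC mp) iotaD filter_cat add0n.
rewrite (eq_in_filter (a2 := predT)) => [|a]; last first.
  by rewrite mem_iota.
rewrite filter_predT (eq_in_filter (a2 := pred0)) => [|a]; last first.
  by rewrite mem_iota /= => /andP[+ _]; rewrite leqNgt => /negPf.
by rewrite filter_pred0 cats0.
Qed.

Lemma map_ord_ge m : (m <= p)%N -> map val (ord_ge m) = iota m (p - m).
Proof.
move=> mp; rewrite /ord_ge -(filter_map val (fun a => m <= a)%N) val_enum_ord.
rewrite -{1}(subnKC mp) iotaD filter_cat add0n.
rewrite (eq_in_filter (a2 := pred0)) => [|a]; last first.
  by rewrite mem_iota /= add0n ltnNge => /negPf.
rewrite filter_pred0 (eq_in_filter (a2 := predT)) => [|a]; last first.
  by rewrite mem_iota /= => /andP[].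
by rewrite filter_predT.
Qed.

Lemma ord_lt_ge m : (m <= p)%N -> enum 'I_p = ord_lt m ++ ord_ge m.
Proof.
move=> mp; apply: (inj_map val_inj).
by rewrite val_enum_ord map_cat map_ord_lt// map_ord_ge// -iotaD subnKC.
Qed.

Lemma size_ord_lt m : (m <= p)%N -> size (ord_lt m) = m.
Proof. by move=> mp; rewrite -(size_map val) map_ord_lt// size_iota. Qed.

Lemma size_ord_ge m : (m <= p)%N -> size (ord_ge m) = (p - m)%N.
Proof. by move=> mp; rewrite -(size_map val) map_ord_ge// size_iota. Qed.

Lemma ord_ge_cons (k : 'I_p) : ord_ge k = k :: ord_ge k.+1.
Proof.
apply: (inj_map val_inj); rewrite /= map_ord_ge 1?ltnW// map_ord_ge//.
by rewrite -(subnSK (ltn_ord k)).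
Qed.

Lemma ord_lt_rcons (k : 'I_p) : ord_lt k.+1 = rcons (ord_lt k) k.
Proof.
apply: (inj_map val_inj); rewrite map_rcons map_ord_lt// map_ord_lt 1?ltnW//.
by rewrite -addn1 iotaD cats1.
Qed.

Lemma ord_lt0 : ord_lt 0 = [::].
Proof. by apply: size0nil; rewrite size_ord_lt. Qed.

Lemma ord_ge_max : ord_ge p = [::].
Proof. by apply: size0nil; rewrite size_ord_ge// subnn. Qed.

End OrdinalIntervals.

(** * Residues of the three parts of D_i *)

Section Residues.
Variables (n : nat) (K : fieldType) (q : K) (q_neq0 : q != 0).
Variables (last : 'I_n) (last_val : last = n.-1 :> nat).
Local Notation F := (ratf n (Ctau K)).
Local Notation x := (@ratX n (Ctau K)).
Local Notation C := (@ratC n (Ctau K)).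
Local Notation t := (C tau).
Local Notation tpow := (@tpow n K q).
Local Notation tshift := (@tshift n K q).
Local Notation has_res := (@has_res n K q).
Local Notation sk k := (tperm (idx k) (idxS k)).
Local Notation opTs := (foldr (@opT n K)).
Local Notation opTVs := (foldr (@opTV n K)).
Local Notation pc := (perm (@ord_pred_inj n)).

(** The constants of the substitution pi^-1 for e = 1, and their inverses for e = -1. *)
Let qpi (e : int) (i : 'I_n) : Ctau K := if i == 0%N :> nat then cst (q ^ e) else 1.

Let qpiK i : qpi 1 i * qpi (-1) i = 1.
Proof.
rewrite /qpi; case: ifP => _; last exact: mulr1.
exact: (cst_expzK q_neq0 1).
Qed.

Lemma oppiE :
  @oppi n K q = ratsubst (fun i => C (qpi 1 i) * x (pc i)).
Proof.
congr ratsubst; apply/funext => i; rewrite permE /qpi expr1z.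
by case: ifP => _; rewrite ?(rmorph1 C).
Qed.

Lemma oppi_zmod_morphism : zmod_morphism (@oppi n K q).
Proof. rewrite oppiE; exact: ratsubst_zmod_morphism qpiK. Qed.

Lemma oppi_monoid_morphism : monoid_morphism (@oppi n K q).
Proof. rewrite oppiE; exact: ratsubst_monoid_morphism qpiK. Qed.

HB.instance Definition _ := GRing.isZmodMorphism.Build F F (@oppi n K q)
  oppi_zmod_morphism.
HB.instance Definition _ := GRing.isMonoidMorphism.Build F F (@oppi n K q)
  oppi_monoid_morphism.

Lemma ord_pred_eq_last (i : 'I_n) : (ord_pred i == last) = (i == 0%N :> nat).
Proof.
rewrite -val_eqE /= last_val; have := ltn_ord i.
case: (i : nat) => [|i'] /=.
  by case: n => // n' _; rewrite modn_small// !eqxx.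
case: n => // n' i'n; have -> : (i' + n'.+1)%N = (n'.+1 + i')%N by rewrite addnC.
by rewrite modnDl modn_small ?(ltnW i'n)//= ltn_eqF.
Qed.

(** Thus pi^-1 is a single term t_n w with w cyclic, and its residue is t_n. *)
Lemma oppi_tshift f : oppi q f = tshift last 1 (permop pc f).
Proof.
pose tp := tpow_rmorphism q_neq0 [ffun j => if j == last then 1 else 0].
rewrite -[RHS]/((tp \o permop pc) f); apply: ratf_rmorph_eq => [c|i] /=.
  by rewrite oppiE (ratsubstC _ qpiK) permopC tpowC.
rewrite oppiE (ratsubstX _ qpiK) permopX tpowX// ffunE permE ord_pred_eq_last.
by rewrite /qpi; case: ifP => _; rewrite ?expr0z /cst ?rmorph1.
Qed.

Definition opi (f : F) : F := permop (pc^-1)%g (tshift last (-1) f).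

Lemma oppiK f : opi (oppi q f) = f.
Proof. by rewrite oppi_tshift /opi tshiftK// permopM mulgV permop1. Qed.

Lemma sum_tshift_permop k e (g : 'I_n -> F) f :
  permop (sk k) (\sum_(j < n) g j * tshift j e (permop (sk k) f)) =
  \sum_(j < n) permop (sk k) (g (sk k j)) * tshift j e f.
Proof.
rewrite (rmorph_sum (permop (sk k))) (reindex_inj (@perm_inj _ (sk k))) /=.
apply: eq_bigr => j _; rewrite permop_mul; congr (_ * _).
by rewrite permop_tshift// permopM tperm2 permop1 tpermK.
Qed.

(** The coefficient of the shift takes the shape of the left side of [coef_up_step] and
    [coef_down_step]. *)
Lemma has_res_opT_tshift k e (A : F -> F) (g : 'I_n -> F) :
  has_res A (fun f => \sum_(j < n) g j * tshift j e f) ->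
  has_res (fun f => opT k (A f))
    (fun f => \sum_(j < n) ((t + hecke_coef t x k) * permop (sk k) (g (sk k j))
                            - hecke_coef t x k * g j) * tshift j e f).
Proof.
move/(has_res_opT_l q_neq0 k)/has_res_eq; apply=> f //.
rewrite sum_tshift_permop !mulr_sumr -sumrB; apply: eq_bigr => j _.
by rewrite [RHS]mulrBl; congr (_ - _); exact: mulrA.
Qed.

Let x_neq0 i : x i != 0. Proof. exact: ratX_neq0. Qed.
Let x_inj : injective x. Proof. exact: ratX_inj. Qed.
Let t0 : t != 0. Proof. exact: ratC_tau_neq0. Qed.

Lemma permop_comp_ratX w : permop w \o x = x \o w.
Proof. by apply/funext => i; exact: permopX. Qed.

Lemma permop_coef_up w i j : permop w (coef_up t x i j) = coef_up t (x \o w) i j.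
Proof.
have /= -> := rmorph_coef_up (permop w) t x i j.
by rewrite permopC permop_comp_ratX.
Qed.

Lemma permop_coef_down w i j :
  permop w (coef_down t x i j) = coef_down t (x \o w) i j.
Proof.
have /= -> := rmorph_coef_down (permop w) t x i j.
by rewrite permopC permop_comp_ratX.
Qed.

(** Induction on the distance d from i to the last index. Lowering i by one multiplies by one more
    T_k on the left, which is [coef_up_step]. *)
Lemma has_res_up (i : 'I_n) :
  has_res (fun f => opTs ((x last)^-1 * oppi q f) (ord_ge n.-1 i))
          (fun f => \sum_(j < n) coef_up t x i j * tshift j 1 f).
Proof.
have [d di] : exists d, (i + d)%N = last.
  by exists (last - i)%N; rewrite subnKC// last_val -ltnS (ltn_predK (ltn_ord i)).
elim: d i di => [|d IHd] i.
  rewrite addn0 => /val_inj->; rewrite last_val ord_ge_max /=.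
  apply: has_res_eq (has_res_term q (x last)^-1
    [ffun j => if j == last then 1 else 0] pc) _ _ => f.
    by rewrite oppi_tshift.
  (* Every other j is below the last index and has coefficient 0. *)
  rewrite (bigD1 last) //= big1 => [|j jl]; last first.
    rewrite /coef_up ltn_neqAle last_val -ltnS (ltn_predK (ltn_ord j)) ltn_ord.
    by rewrite -last_val (inj_eq val_inj) jl !mul0r.
  rewrite /coef_up ltnn eqxx big_pred0 ?mulr1 ?addr0// => l.
  by rewrite last_val ltnNge -ltnS (ltn_predK (ltn_ord l)) ltn_ord.
rewrite addnS => di.
have ip : (i < n.-1)%N by rewrite -last_val -di ltnS leq_addr.
pose k := Ordinal ip; have -> : i = idx k by apply: val_inj.
have /(has_res_opT_tshift k) := IHd (idxS k) di.
rewrite -[ord_ge _ (idxS k)]/(ord_ge _ k.+1).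
rewrite -[ord_ge _ (idx k)]/(ord_ge _ k) ord_ge_cons.
move/has_res_eq; apply=> // f; apply: eq_bigr => j _; congr (_ * _).
by rewrite permop_coef_up coef_up_step.
Qed.

(** Induction upwards from i = 0, where the operator is pi alone, with [coef_down_step] for each
    further T_k on the left. *)
Lemma has_res_down (i : 'I_n) :
  has_res (fun f => opTs (opi f) (rev (ord_lt n.-1 i)))
          (fun f => \sum_(j < n) coef_down t x i j * tshift j (-1) f).
Proof.
case: i => i; elim: i => [|i IHi] i_lt /=.
  rewrite ord_lt0 /=.
  set i0 := Ordinal i_lt.
  (* Moving the inverse cycle to the right of the shift turns t_n^-1 into t_1^-1. *)
  have pi0 : (pc^-1)%g last = i0.
    apply: (canLR (permK _)); apply/eqP.
    by rewrite permE eq_sym ord_pred_eq_last.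
  apply: has_res_eq (has_res_term q 1
    [ffun j => if j == i0 then -1 else 0] (pc^-1)%g) _ _ => f.
    by rewrite mul1r /opi permop_tshift// pi0.
  rewrite (bigD1 i0) //= big1 => [|j jl]; last first.
    have j_gt0 : (0 < j)%N by rewrite lt0n.
    by rewrite /coef_down /= j_gt0 !mul0r.
  rewrite /coef_down ltnn eqxx big_pred0 ?mulr1 ?addr0//.
have ip : (i < n.-1)%N by rewrite -ltnS (ltn_predK i_lt).
pose k := Ordinal ip; have -> : Ordinal i_lt = idxS k by apply: val_inj.
have i_lt' : (i < n)%N by apply: ltnW.
have /(has_res_opT_tshift k) := IHi i_lt'.
have -> : Ordinal i_lt' = idx k by apply: val_inj.
rewrite -[ord_lt n.-1 i.+1]/(ord_lt n.-1 k.+1) ord_lt_rcons rev_rcons.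
move/has_res_eq; apply=> // f; apply: eq_bigr => j _; congr (_ * _).
by rewrite permop_coef_down coef_down_step.
Qed.
(** Y_n^-1 = T_{n-1} ... T_1 pi, from inverting Y_n = pi^-1 T_1^-1 ... T_{n-1}^-1. *)
Definition opYV (f : F) : F := opTs (opi f) (rev (enum 'I_n.-1)).

Lemma opTs_opTVs_rev s f : opTs (opTVs f s) (rev s) = f.
Proof. by elim: s => //= k s IHs; rewrite rev_cons foldr_rcons opTVT. Qed.

Lemma opTVs_opTs_rev s f : opTVs (opTs f (rev s)) s = f.
Proof.
elim: s f => //= k s IHs f.
by rewrite rev_cons foldr_rcons IHs opTTV.
Qed.

Lemma opTs_add s f g : opTs (f + g) s = opTs f s + opTs g s.
Proof. by elim: s => //= k s ->; rewrite opT_add. Qed.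

Lemma opTs_scale s c f : opTs (C c * f) s = C c * opTs f s.
Proof. by elim: s => //= k s ->; rewrite opT_scale. Qed.

Lemma opY_last f : opY q last f = oppi q (opTVs f (enum 'I_n.-1)).
Proof.
rewrite /opY -[X in foldr _ _ X]/(ord_ge n.-1 last) last_val ord_ge_max /=.
by rewrite [in RHS](ord_lt_ge (leqnn n.-1)) ord_ge_max cats0.
Qed.

Lemma opYK f : opYV (opY q last f) = f.
Proof. by rewrite opY_last /opYV oppiK opTs_opTVs_rev. Qed.

Lemma opTs_ratXV_conj (i : 'I_n) f :
  opTs ((x last)^-1 * opTs f (rev (ord_ge n.-1 i))) (ord_ge n.-1 i) =
  (x i)^-1 * f.
Proof.
have [d di] : exists d, (i + d)%N = last.
  by exists (last - i)%N; rewrite subnKC// last_val -ltnS (ltn_predK (ltn_ord i)).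
elim: d i di f => [|d IHd] i.
  by rewrite addn0 => /val_inj-> f; rewrite last_val ord_ge_max.
rewrite addnS => di f.
have ip : (i < n.-1)%N by rewrite -last_val -di ltnS leq_addr.
pose k := Ordinal ip; have -> : i = idx k by apply: val_inj.
rewrite -[ord_ge _ (idx k)]/(ord_ge _ k) ord_ge_cons rev_cons foldr_rcons /=.
rewrite -[ord_ge _ k.+1]/(ord_ge _ (idxS k)) IHd//.
exact: opT_ratX_conj.
Qed.

Let ord_leq_pred (i : 'I_n) : (i <= n.-1)%N.
Proof. by rewrite -ltnS (ltn_predK (ltn_ord i)). Qed.

Definition opD11 (a b c : Ctau K) (i : 'I_n) (f : F) : F :=
  let g := opTs f (rev (ord_ge n.-1 i)) in
  opTs ((x last)^-1 * (C a * opY q last g + C b * opYV g + C c * g))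
    (ord_ge n.-1 i).

(** In the a part the factors T_i^-1 ... T_{n-1}^-1 of Y_n cancel T_{n-1} ... T_i on the right. In
    the b part Y_n^-1 starts with T_{n-1} ... T_i, so X_n^-1 is conjugated into X_i^-1, as it is in
    the c part. *)
Lemma opD11E a b c i f :
  opD11 a b c i f =
    C a * opTs ((x last)^-1 * oppi q (opTVs f (ord_lt n.-1 i))) (ord_ge n.-1 i)
  + C b * ((x i)^-1 *
           opTs (opi (opTs f (rev (ord_ge n.-1 i)))) (rev (ord_lt n.-1 i)))
  + C c * ((x i)^-1 * f).
Proof.
have lin (y u v w : F) : y * (C a * u + C b * v + C c * w) =
    C a * (y * u) + C b * (y * v) + C c * (y * w).
  by rewrite !mulrDr; congr (_ + _ + _); exact: mulrCA.
rewrite /opD11 lin !opTs_add !opTs_scale.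
rewrite opTs_ratXV_conj opY_last (ord_lt_ge (ord_leq_pred i)) foldr_cat.
rewrite opTVs_opTs_rev /opYV (ord_lt_ge (ord_leq_pred i)) rev_cat foldr_cat.
by rewrite opTs_ratXV_conj.
Qed.

Lemma has_res_opD11 a b c i :
  has_res (opD11 a b c i) (fun f =>
      C a * (t ^- i * \sum_(j < n) coef_up t x i j * tshift j 1 f)
    + C b * (t ^+ (n - i.+1) *
             ((x i)^-1 * \sum_(j < n) coef_down t x i j * tshift j (-1) f))
    + C c * ((x i)^-1 * f)).
Proof.
have Ra := has_res_mull (C a) (has_res_opTV_rs q_neq0 (ord_lt n.-1 i) (has_res_up i)).
have Rb := has_res_mull (C b) (has_res_opT_rs q_neq0 (rev (ord_ge n.-1 i))
  (has_res_mull (x i)^-1 (has_res_down i))).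
have Rc := has_res_mull (C c) (has_res_mull (x i)^-1 (has_res_id n q_neq0)).
apply: has_res_eq (has_resD (has_resD Ra Rb) Rc) _ _ => f.
  by rewrite opD11E.
rewrite size_ord_lt// size_rev size_ord_ge//.
(* With i counted from 0, n-1-i generators stand on the right. *)
by have -> : (n.-1 - i = n - i.+1)%N by lia.
Qed.

Lemma has_res_sum_opD11 a b c :
  has_res (fun f => \sum_(i < n) opD11 a b c i f) (fun f =>
    C a * t ^- n.-1 * (\sum_(i < n) (x i)^-1 *
      (\prod_(j < n | j != i) ((t ^+ 2 * x i - x j) / (x i - x j))) *
      tshift i 1 f)
  + C b * t ^- n.-1 * (\sum_(i < n) (x i)^-1 *
      (\prod_(j < n | j != i) ((x i - t ^+ 2 * x j) / (x i - x j))) *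
      tshift i (-1) f)
  + C c * (\sum_(i < n) (x i)^-1) * f).
Proof.
apply: has_res_eq (has_res_sum _ (fun i _ => has_res_opD11 a b c i)) _ _ => f //.
rewrite !big_split /= -!mulr_sumr -!(mulrA (C _)); congr (_ + _ + _).
- by congr (_ * _); exact: sum_coef_up.
- by congr (_ * _); exact: sum_coef_down.
- by rewrite mulr_suml.
Qed.

End Residues.

(** * The elements D_i in the polynomial representation *)

Section PolynomialRepresentation.
Variables (n : nat) (n_gt1 : (2 <= n)%N) (K : fieldType) (q : K).
Hypothesis q_neq0 : q != 0.
Local Notation F := (ratf n (Ctau K)).
Local Notation L := (laurent n (Ctau K)).
Local Notation x := (@ratX n (Ctau K)).
Local Notation C := (@ratC n (Ctau K)).
Local Notation last := (ord_last n_gt1).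
Variable rho : daha n q -> L -> L.
Hypothesis rhoP : polynomial_representation rho.

Let last_val : last = n.-1 :> nat. Proof. by []. Qed.

Lemma rho_sum (I : Type) (r : seq I) (P : pred I) (h : I -> daha n q) (f : L) :
  rho (\sum_(i <- r | P i) h i) f = \sum_(i <- r | P i) (rho (h i) f : F) :> F.
Proof.
apply: (big_morph (fun h => rho h f : F)) => [g h'|].
  by rewrite (rho_addl rhoP); exact: (rmorphD val).
have -> : rho 0 f = 0; last exact: (rmorph0 val).
by apply: (addrI (rho 0 f)); rewrite -(rho_addl rhoP) !addr0.
Qed.

Lemma rho_prodT (s : seq 'I_n.-1) (f : L) :
  rho (\prod_(k <- s) dT q k) f = foldr (@opT n K) (f : F) s :> F.
Proof.
elim: s => [|k s IHs] /=; first by rewrite big_nil (rho_one rhoP).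
by rewrite big_cons (rho_mul rhoP) (rho_T rhoP) IHs.
Qed.

Lemma dYK (i : 'I_n) : dY q i * dYV q i = 1.
Proof.
rewrite -[LHS]/(muld _ _) /dY /dYV -pi_muld.
exact/daha_pi/daha_YV.
Qed.

(** Only Y_n has a prescribed formula. As Y_n Y_n^-1 = 1, f is Y_n applied to the image of f under
    Y_n^-1, and [opYV] undoes Y_n. *)
Lemma rho_YV_last (f : L) : rho (dYV q last) f = opYV q last (f : F) :> F.
Proof.
rewrite -{2}(rho_one rhoP f) -(dYK last) (rho_mul rhoP) (rho_Y rhoP).
by rewrite opYK.
Qed.

Lemma rho_D11 a b c i (f : L) :
  rho (D11 n_gt1 q a b c i) f = opD11 q last (cst a) (cst b) (cst c) i (f : F) :> F.
Proof.
have scaleE (e : Ctau K) (g : L) : (e *: g : L) = C e * (g : F) :> F.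
  by rewrite -[e *: g]/(laurentC _ _ * g).
have addE (g h : L) : g + h = (g : F) + (h : F) :> F by exact: (rmorphD val).
rewrite /D11 -(big_filter (enum _)) -(big_filter (rev _)).
rewrite (rho_mul rhoP) (rho_mul rhoP) rho_prodT.
rewrite /D11_last (rho_mul rhoP) (rho_XV rhoP) !(rho_addl rhoP) !(rho_scale rhoP).
rewrite (rho_one rhoP) !addE !scaleE (rho_Y rhoP) rho_YV_last.
by rewrite rho_prodT filter_rev.
Qed.

End PolynomialRepresentation.

Theorem proposition6p8 (R : realType) (n : nat) (n_gt1 : (2 <= n)%N)
  (q : R[i]) (q_neq0 : q != 0)
  (q_not_root1 : forall m : nat, (0 < m)%N -> q ^+ m != 1)
  (a b c : R[i])
  (rho : daha n q -> laurent n (Ctau R[i]) -> laurent n (Ctau R[i]))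
  (rho_polrep : polynomial_representation rho)
  (f : ratf n (Ctau R[i])) :
  let X := @ratX n (Ctau R[i]) in
  let s := @ratC n (Ctau R[i]) in
  Res q (rho (\sum_(i < n) D11 n_gt1 q a b c i)) f =
    s (cst a * tau ^ (1 - n%:Z)) *
      (\sum_(i < n) (X i)^-1 *
        (\prod_(j < n | j != i) ((s (tau ^+ 2) * X i - X j) / (X i - X j))) *
        tshift q i 1 f)
    + s (cst b * tau ^ (1 - n%:Z)) *
      (\sum_(i < n) (X i)^-1 *
        (\prod_(j < n | j != i) ((X i - s (tau ^+ 2) * X j) / (X i - X j))) *
        tshift q i (-1) f)
    + s (cst c) * (\sum_(i < n) (X i)^-1) * f.
Proof.
move=> X s.
rewrite {}/X {}/s !(ratC_mul_tau_expz _ (ltnW n_gt1)) ratC_tau_sq.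
apply: (has_res_Res q_neq0 q_not_root1
  (has_res_sum_opD11 q_neq0 (erefl : ord_last n_gt1 = n.-1 :> nat) _ _ _)) => g.
rewrite (rho_sum rho_polrep).
by apply: eq_bigr => i _; exact: rho_D11.
Qed.
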